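(* Let $\alpha>0$, $1\le p<\infty$, and let $\sigma,w$ be two weights on $\mathbb{C}^n$. Suppose that $w$ is $r$-doubling for some $r>0$. Then $P_\alpha:L^p_{\alpha,\sigma}\to L^p_{\alpha,w}$ is bounded if and only if $[w,\sigma]_{A_{p,r}}<\infty$. Moreover, $$\|P_\alpha\|_{L^p_{\alpha,\sigma}\to L^p_{\alpha,w}}\asymp[w,\sigma]_{A_{p,r}}^{1/p},$$ that is, each side is at most a constant multiple of the other, where the implicit constants depend only on $p,n,\alpha,r$ and the $r$-doubling constant of $w$.
   Context: Let $dv$ be Lebesgue measure on $\mathbb{C}^n$ and $\langle z,u\rangle=\sum_j z_j\overline{u_j}$. A weight on $\mathbb{C}^n$ is a nonnegative locally integrable function; $w(E)=\int_E w\,dv$. For a weight $w$ and $1\le p<\infty$, $L^p_{\alpha,w}$ is the space of measurable $f$ with $\|f\|^p_{L^p_{\alpha,w}}=\int_{\mathbb{C}^n}|f(z)|^pe^{-\frac{p\alpha}{2}|z|^2}w(z)\,dv(z)<\infty$. $Q$ denotes a cube in $\mathbb{C}^n\cong\mathbb{R}^{2n}$, $l(Q)$ its side length, and $Q_r(z)$ is the cube centered at $z$ with side length $r$. A weight $w$ is $r$-doubling if there is $C=C(r)\ge1$ with $w(Q_{2r}(z))\le C\,w(Q_r(z))$ for all $z\in\mathbb{C}^n$; such a $C$ is an $r$-doubling constant of $w$. The Fock projection is $P_\alpha f(z)=\int_{\mathbb{C}^n}f(u)e^{\alpha\langle z,u\rangle}\,d\lambda_\alpha(u)$, with $d\lambda_\alpha(u)=(\alpha/\pi)^ne^{-\alpha|u|^2}dv(u)$.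 That $P_\alpha:L^p_{\alpha,\sigma}\to L^p_{\alpha,w}$ is bounded means: for every $f\in L^p_{\alpha,\sigma}$ the integral converges absolutely for $w\,dv$-almost every $z$, and $\|P_\alpha f\|_{L^p_{\alpha,w}}\le C\|f\|_{L^p_{\alpha,\sigma}}$ with $C$ independent of $f$. For $1<p<\infty$ and $1/p+1/p'=1$, $$[w,\sigma]_{A_{p,r}}=\sup_{Q:\,l(Q)=r}\left(\frac{1}{v(Q)}\int_Q w\,dv\right)\left(\frac{1}{v(Q)}\int_Q\sigma^{-\frac{p'}{p}}\,dv\right)^{\frac{p}{p'}},$$ and $$[w,\sigma]_{A_{1,r}}=\sup_{Q:\,l(Q)=r}\left(\frac{1}{v(Q)}\int_Q w\,dv\right)\|\sigma^{-1}\|_{L^\infty(Q)}.$$ Negative powers of $0$ are read as $\infty$, and $0\cdot\infty=0$. *)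

(* Defs.v *)
From HB Require Import structures.
From mathcomp Require Import all_boot all_order all_algebra.
From mathcomp Require Import all_classical all_reals all_analysis.
From mathcomp Require Import complex.
From mathcomp Require Import ring lra.

Set Implicit Arguments.
Unset Strict Implicit.
Unset Printing Implicit Defensive.
Import Order.TTheory GRing.Theory Num.Theory.
Import numFieldNormedType.Exports.
Import Normc.

Local Open Scope classical_set_scope.
Local Open Scope complex_scope.
Local Open Scope ring_scope.

Section complex_measurable.
Variable R : realType.

Definition complex_pair (z : R[i]) :
  measurableTypeR R * measurableTypeR R := (complex.Re z, complex.Im z).

Definition pair_complex (p : measurableTypeR R * measurableTypeR R) : R[i] :=
  p.1 +i* p.2.

Lemma complex_pairK : cancel complex_pair pair_complex.
Proof. by case. Qed.

Lemma pair_complexK : cancel pair_complex complex_pair.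
Proof. by case. Qed.

HB.instance Definition _ := isPointed.Build R[i] 0.

(* The Borel sigma-algebra of R[i], transported from R * R; n.-tuple R[i],
   our C^n, then carries the library's product sigma-algebra. *)
HB.instance Definition _ :=
  Measurable.copy R[i] (g_sigma_algebra_preimageType complex_pair).

Lemma measurable_complex_pair : measurable_fun [set: R[i]] complex_pair.
Proof. by move=> _ Y mY; exists Y. Qed.

Lemma measurable_pair_complex : measurable_fun setT pair_complex.
Proof.
move=> _ _ [B mB <-]; rewrite !setTI -comp_preimage.
rewrite (_ : _ \o _ = id) ?preimage_id//.
by apply/funext => p /=; rewrite pair_complexK.
Qed.

Lemma measurable_Re : measurable_fun [set: R[i]] (@complex.Re R).
Proof.
rewrite (_ : @complex.Re R = fst \o complex_pair)//.
exact: (measurableT_comp measurable_fst measurable_complex_pair).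
Qed.

Lemma measurable_Im : measurable_fun [set: R[i]] (@complex.Im R).
Proof.
rewrite (_ : @complex.Im R = snd \o complex_pair)//.
exact: (measurableT_comp measurable_snd measurable_complex_pair).
Qed.

End complex_measurable.

(* The library only registers sigma-finiteness of the product of two
   subprobabilities. *)
Lemma sigma_finite_product_measure1 d1 d2 (T1 : measurableType d1)
    (T2 : measurableType d2) (R : realType)
    (m1 : {sigma_finite_measure set T1 -> \bar R})
    (m2 : {sigma_finite_measure set T2 -> \bar R}) :
  sigma_finite setT (m1 \x m2)%E.
Proof.
have /sigma_finiteP[F [TF ndF Foo]] := sigma_finiteT m1.
have /sigma_finiteP[G [TG ndG Goo]] := sigma_finiteT m2.
exists (fun n => F n `*` G n).
  rewrite -setXTT TF TG predeqE => -[x y]; split.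
    move=> [/= [n _ Fnx] [k _ Gky]]; exists (maxn n k) => //; split.
    - by move: x Fnx; exact/subsetPset/ndF/leq_maxl.
    - by move: y Gky; exact/subsetPset/ndG/leq_maxr.
  by move=> [n _ []/= ? ?]; split; exists n.
move=> k; have [? ?] := Foo k; have [? ?] := Goo k.
split; first exact: measurableX.
by rewrite product_measure1E// lte_mul_pinfty// ge0_fin_numE.
Qed.

(* Pushforward along a measurable bijection with measurable inverse preserves
   sigma-finiteness, which product measures require of their right factor. *)
Lemma pushforward_sigma_finite_measure d1 d2 (T1 : measurableType d1)
    (T2 : measurableType d2) (R : realType)
    (m : {measure set T1 -> \bar R}) (f : T1 -> T2) (g : T2 -> T1) :
  sigma_finite setT m -> measurable_fun setT f -> measurable_fun setT g ->
  cancel f g -> cancel g f ->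
  exists mu : {sigma_finite_measure set T2 -> \bar R},
    (mu : set T2 -> \bar R) = pushforward m f.
Proof.
move=> sfm mf mg fK gK.
pose pm : {measure set T2 -> \bar R} :=
  measure_function_pushforward__canonical__measure_function_Measure m mf.
have sf : sigma_finite setT pm.
  have [F TF mF] := sfm.
  exists (fun i => g @^-1` F i).
    by rewrite -preimage_bigcup -TF preimage_setT.
  move=> i; have [mFi Fioo] := mF i; split.
    by rewrite -[X in measurable X]setTI; exact: mg.
  rewrite /pm /= /pushforward -comp_preimage (_ : _ \o _ = id) ?preimage_id//.
  by apply/funext => x /=; rewrite fK.
pose X := Measure_isSigmaFinite.Build _ _ _ (pm : set T2 -> \bar R) sf.
pose mu : {sigma_finite_measure set T2 -> \bar R} :=
  HB.pack (pushforward m f) (Measure.class pm) X.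
by exists (mu mf).
Qed.

Section complex_lebesgue_measure.
Variable R : realType.

Definition complex_lebesgue : set R[i] -> \bar R :=
  pushforward (lebesgue_measure \x lebesgue_measure)%E (@pair_complex R).

Let E : exists mu : {sigma_finite_measure set R[i] -> \bar R},
  (mu : set R[i] -> \bar R) = complex_lebesgue.
Proof.
apply: pushforward_sigma_finite_measure.
- exact: sigma_finite_product_measure1.
- exact: measurable_pair_complex.
- exact: measurable_complex_pair.
- exact: pair_complexK.
- exact: complex_pairK.
Qed.

Let cl0 : complex_lebesgue set0 = 0%E.
Proof. by have [mu <-] := E; exact: measure0. Qed.

Let cl_ge0 A : (0 <= complex_lebesgue A)%E.
Proof. by have [mu <-] := E; exact: measure_ge0. Qed.

Let cl_sigma_additive : semi_sigma_additive complex_lebesgue.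
Proof. by have [mu <-] := E; exact: measure_semi_sigma_additive. Qed.

HB.instance Definition _ := isMeasure.Build _ _ _ complex_lebesgue
  cl0 cl_ge0 cl_sigma_additive.

Let cl_sigma_finite : sigma_finite setT complex_lebesgue.
Proof. by have [mu <-] := E; exact: sigma_finiteT. Qed.

HB.instance Definition _ := Measure_isSigmaFinite.Build _ _ _ complex_lebesgue
  cl_sigma_finite.

End complex_lebesgue_measure.

Section lebesgue_Cn.
Variable R : realType.

Definition consC n (x : R[i] * n.-tuple R[i]) : n.+1.-tuple R[i] :=
  [tuple of x.1 :: x.2].

Definition unconsC n (t : n.+1.-tuple R[i]) : R[i] * n.-tuple R[i] :=
  (thead t, [tuple of behead t]).

Lemma consCK n : cancel (@consC n) (@unconsC n).
Proof. by move=> [x t]; rewrite /unconsC /consC /= theadE; congr pair; exact/val_inj. Qed.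

Lemma unconsCK n : cancel (@unconsC n) (@consC n).
Proof. by move=> t; rewrite /unconsC /consC /= -tuple_eta. Qed.

Lemma measurable_consC n : measurable_fun setT (@consC n).
Proof. by apply: measurable_cons. Qed.

Lemma measurable_unconsC n : measurable_fun setT (@unconsC n).
Proof.
by apply/measurable_fun_pair; [exact: measurable_tnth|exact: measurable_behead].
Qed.

(* Lebesgue measure on C^n = R^2n, as an iterated product measure. *)
Fixpoint lebesgue_Cn n : set (n.-tuple R[i]) -> \bar R :=
  match n with
  | 0 => \d_([tuple] : 0.-tuple R[i])
  | m.+1 => pushforward (@complex_lebesgue R \x lebesgue_Cn (n := m))%E
              (@consC m)
  end.

Lemma lebesgue_CnE n :
  exists mu : {sigma_finite_measure set (n.-tuple R[i]) -> \bar R},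
    (mu : set (n.-tuple R[i]) -> \bar R) = @lebesgue_Cn n.
Proof.
elim: n => [|n [mu IH]] /=; first by exists \d_([tuple] : 0.-tuple R[i]).
rewrite -IH; apply: pushforward_sigma_finite_measure.
- exact: sigma_finite_product_measure1.
- exact: measurable_consC.
- exact: measurable_unconsC.
- exact: consCK.
- exact: unconsCK.
Qed.

Section lebesgue_Cn_measure.
Variable n : nat.
Let E := lebesgue_CnE n.

Let leb0 : @lebesgue_Cn n set0 = 0%E.
Proof. by have [mu <-] := E; exact: measure0. Qed.

Let leb_ge0 A : (0 <= @lebesgue_Cn n A)%E.
Proof. by have [mu <-] := E; exact: measure_ge0. Qed.

Let leb_sigma_additive : semi_sigma_additive (@lebesgue_Cn n).
Proof. by have [mu <-] := E; exact: measure_semi_sigma_additive. Qed.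

HB.instance Definition _ := isMeasure.Build _ _ _ (@lebesgue_Cn n)
  leb0 leb_ge0 leb_sigma_additive.

Let leb_sigma_finite : sigma_finite setT (@lebesgue_Cn n).
Proof. by have [mu <-] := E; exact: sigma_finiteT. Qed.

HB.instance Definition _ := Measure_isSigmaFinite.Build _ _ _ (@lebesgue_Cn n)
  leb_sigma_finite.

End lebesgue_Cn_measure.
End lebesgue_Cn.

Arguments lebesgue_Cn {R n}.

Section fock.
Variables (R : realType) (n : nat).
Local Notation Cn := (n.-tuple R[i]).
Local Notation v := (@lebesgue_Cn R n).
Implicit Types (z u : Cn) (w sigma : Cn -> R) (f : Cn -> R[i]).

Definition inner z u : R[i] := \sum_(j < n) tnth z j * conjc (tnth u j).

Definition sqnorm z : R := \sum_(j < n) normc (tnth z j) ^+ 2.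

(* Measurable for the completion of the Borel sigma-algebra: Borel measurable
   up to a null set. The library integral of a nonnegative function, being a
   supremum over simple functions below it, is insensitive to null sets. *)
Definition Lebesgue_measurable d (T : measurableType d) (f : Cn -> T) : Prop :=
  exists2 g : Cn -> T, measurable_fun setT g & {ae v, forall z, f z = g z}.

Definition wmass w (E : set Cn) : \bar R := \int[v]_(z in E) (w z)%:E.

Definition cube (r : R) z : set Cn :=
  [set u | forall j, `|complex.Re (tnth u j - tnth z j)| <= r / 2 /\
                     `|complex.Im (tnth u j - tnth z j)| <= r / 2].

(* Every compact set lies in a cube, and every cube is compact: the last clause
   is local integrability. *)
Definition weight w : Prop :=
  [/\ forall z, 0 <= w z,
      Lebesgue_measurable (w : Cn -> measurableTypeR R)
    & forall z r, 0 < r -> (wmass w (cube r z) < +oo)%E].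

Definition doubling (r C : R) w : Prop :=
  1 <= C /\ forall z, (wmass w (cube (2 * r) z) <= C%:E * wmass w (cube r z))%E.

Definition fock_energy (p alpha : R) w f : \bar R :=
  \int[v]_z (normc (f z) `^ p * expR (- (p * alpha / 2) * sqnorm z) * w z)%:E.

Definition fock_norm (p alpha : R) w f : \bar R :=
  (fock_energy p alpha w f `^ p^-1)%E.

Definition fock_space (p alpha : R) w f : Prop :=
  Lebesgue_measurable f /\ (fock_energy p alpha w f < +oo)%E.

Definition cexp (z : R[i]) : R[i] :=
  (expR (complex.Re z) * cos (complex.Im z)) +i*
  (expR (complex.Re z) * sin (complex.Im z)).

Definition complex_integral f : R[i] :=
  (\int[v]_u complex.Re (f u)) +i* (\int[v]_u complex.Im (f u)).

(* The density of lambda_alpha with respect to Lebesgue measure. *)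
Definition gaussian (alpha : R) u : R :=
  (alpha / pi) ^+ n * expR (- alpha * sqnorm u).

Definition fock_integrand (alpha : R) f z u : R[i] :=
  f u * cexp (alpha%:C * inner z u) * (gaussian alpha u)%:C.

Definition fock_proj (alpha : R) f z : R[i] :=
  complex_integral (fock_integrand alpha f z).

Definition fock_proj_cvg (alpha : R) f z : Prop :=
  (\int[v]_u (normc (fock_integrand alpha f z u))%:E < +oo)%E.

(* P holds almost everywhere for the measure w dv. *)
Definition weight_ae w (P : Cn -> Prop) : Prop :=
  exists N : set Cn, [/\ measurable N, wmass w N = 0%E & ~` P `<=` N].

(* P_alpha is well defined from L^p_{alpha,sigma} to L^p_{alpha,w}, with norm
   at most C. *)
Definition fock_proj_bounded_by (p alpha : R) sigma w (C : R) : Prop :=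
  forall f, fock_space p alpha sigma f ->
    weight_ae w (fock_proj_cvg alpha f) /\
    (fock_norm p alpha w (fock_proj alpha f) <=
       C%:E * fock_norm p alpha sigma f)%E.

Definition fock_proj_bounded (p alpha : R) sigma w : Prop :=
  exists C : R, fock_proj_bounded_by p alpha sigma w C.

(* Equal to +oo when P_alpha is not bounded. *)
Definition fock_proj_norm (p alpha : R) sigma w : \bar R :=
  ereal_inf [set C%:E | C in
    [set C : R | 0 <= C /\ fock_proj_bounded_by p alpha sigma w C]].

Definition conj_exponent (p : R) : R := p / (p - 1).

Definition average (Q : set Cn) (F : Cn -> \bar R) : \bar R :=
  ((v Q)^-1 * \int[v]_(z in Q) F z)%E.

(* sigma^(-p'/p) is written (sigma^-1)^(p'/p) in \bar R, where 0^-1 = +oo, so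
   that it is +oo where sigma vanishes; also 0 * +oo = 0 in \bar R. *)
Definition A_const (p r : R) w sigma : \bar R :=
  if p == 1 then
    ereal_sup [set (average (cube r z) (EFin \o w) *
      Lnorm v +oo%E ((fun u => ((sigma u)%:E)^-1) \_ (cube r z)))%E | z in setT]
  else
    let p' := conj_exponent p in
    ereal_sup [set (average (cube r z) (EFin \o w) *
      average (cube r z) (fun u => ((sigma u)%:E)^-1 `^ (p' / p))
        `^ (p / p'))%E | z in setT].

End fock.

Section volume.
Variable R : realType.

Lemma measurable_box n (A : 'I_n -> set R[i]) :
  (forall j, measurable (A j)) ->
  measurable [set z : n.-tuple R[i] | forall j, A j (tnth z j)].
Proof.
move=> mA; rewrite (_ : [set _ | _] = \big[setI/setT]_j (@tnth n _ ^~ j @^-1` A j)).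
  apply: bigsetI_measurable => j _.
  by rewrite -[X in measurable X]setTI; exact: measurable_tnth.
apply/seteqP; split => z /=.
  by move=> Az; apply: (big_ind (fun B : set (n.-tuple R[i]) => B z)) => // j _; exact: Az.
by move=> + j; rewrite (bigD1 j)//= => -[].
Qed.

Lemma lebesgue_Cn_box n (A : 'I_n -> set R[i]) :
  (forall j, measurable (A j)) ->
  lebesgue_Cn [set z : n.-tuple R[i] | forall j, A j (tnth z j)] =
  (\prod_(j < n) complex_lebesgue (A j))%E.
Proof.
elim: n A => [|n IH] A mA.
  by rewrite big_ord0 /= diracE mem_set// => -[].
rewrite /= /pushforward big_ord_recl -IH => [|j]; last exact: mA.
have mB : measurable [set z : n.-tuple R[i] | forall j, A (lift ord0 j) (tnth z j)].
  by apply: (@measurable_box _ (fun j => A (lift ord0 j))) => j; exact: mA.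
rewrite -(product_measure1E _ _ (mA ord0) mB).
congr (_ _); apply/seteqP; split => -[x t] /= h.
  by split=> [|j]; [exact: (h ord0)|have := h (lift ord0 j); rewrite tnthS].
by case: h => h0 h j; case: (unliftP ord0 j) => [k ->|->]; rewrite ?tnthS/=.
Qed.

Lemma measurable_square (a b c d : R) :
  measurable [set x : R[i] | a <= complex.Re x <= b /\ c <= complex.Im x <= d].
Proof.
exists (`[a, b]%classic `*` `[c, d]%classic); first by apply: measurableX; exact: measurable_itv.
rewrite setTI; apply/seteqP; split => x /=; by rewrite !in_itv.
Qed.

Lemma complex_lebesgue_square (a b c d : R) : a <= b -> c <= d ->
  complex_lebesgue [set x : R[i] | a <= complex.Re x <= b /\ c <= complex.Im x <= d]
  = ((b - a) * (d - c))%:E.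
Proof.
move=> ab cd; rewrite /complex_lebesgue /pushforward.
rewrite (_ : _ @^-1` _ = `[a, b]%classic `*` `[c, d]%classic); last first.
  by apply/seteqP; split => x /=; rewrite !in_itv.
rewrite product_measure1E; [|exact: measurable_itv|exact: measurable_itv].
have L (x y : R) : x <= y -> (lebesgue_measure `[x, y]%classic = (y - x)%:E)%E.
  rewrite lebesgue_measure_itv /= lte_fin le_eqVlt => /predU1P[->|->]//.
  by rewrite ltxx subrr.
by rewrite [X in (X * _)%E](L a b)// [X in (_ * X)%E](L c d).
Qed.

Lemma lebesgue_Cn_cube n (r : R) (z : n.-tuple R[i]) : 0 <= r ->
  measurable (cube r z) /\ lebesgue_Cn (cube r z) = (r ^+ (2 * n))%:E.
Proof.
move=> r0; pose A j := [set x : R[i] |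
  complex.Re (tnth z j) - r / 2 <= complex.Re x <= complex.Re (tnth z j) + r / 2 /\
  complex.Im (tnth z j) - r / 2 <= complex.Im x <= complex.Im (tnth z j) + r / 2].
have -> : cube r z = [set u | forall j, A j (tnth u j)].
  apply/seteqP; split => u h j; have := h j; rewrite /A /= !raddfB /= !ler_distl //.
have mA j : measurable (A j) by exact: measurable_square.
split; first exact: measurable_box.
rewrite lebesgue_Cn_box//.
rewrite (eq_bigr (fun=> (r ^+ 2)%:E)); last first.
  move=> j _; rewrite complex_lebesgue_square.
  - congr EFin; lra.
  - lra.
  - lra.
rewrite exprM; elim: n {z A mA} => [|n IH]; first by rewrite big_ord0 expr0.
by rewrite big_ord_recl IH -EFinM -exprS.
Qed.
End volume.

(* Main.v *)
Require Import Defs.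
From mathcomp Require Import all_boot all_order all_algebra.
From mathcomp Require Import all_classical all_reals all_analysis.
From mathcomp Require Import measurable_realfun ess_sup_inf complex.
From mathcomp Require Import ring lra.

Set Implicit Arguments.
Unset Strict Implicit.
Unset Printing Implicit Defensive.
Import Order.TTheory GRing.Theory Num.Theory.
Import numFieldNormedType.Exports.
Import Normc.

Local Open Scope classical_set_scope.
Local Open Scope complex_scope.
Local Open Scope ring_scope.

(** Write v for Lebesgue measure, Q_r(z) for the cube of side r about z, and,
for a function f, g = |f| exp(-alpha |.|^2 / 2) (called [fock_mod]), so that
the p-th power of the norm of f is the integral of g^p against the weight.
Since |exp(alpha <z,u>)| exp(-alpha |z|^2 / 2 - alpha |u|^2 / 2) equals the
Gaussian exp(-alpha |z - u|^2 / 2), the projection is dominated by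
convolution with a Gaussian: exp(-alpha |z|^2 / 2) |P f (z)| is at most
2 (alpha / pi)^n T g (z), with T g the Gaussian convolution of g.

Upper bound.  On a single cube Q of side r, the pointwise Young inequality
g <= l s' + l^(1-p) g^p sigma, with s' = sigma^(-1/(p-1)), integrated and
optimised in l, plays the part of the Hoelder inequality and turns the A_p
condition into
  w(Q) (int_Q g)^p <= C A int_Q g^p sigma     ([A_const_local]).
The doubling condition compares w on two cubes at distance k r / 2 at the
price of D^k ([doubling_chain]), so the same inequality holds with the cube of
side k r under both integrals and a constant growing exponentially in k
([A_const_enlarged]).  The Gaussian is dominated by a combination of
indicators of the cubes Q_(k r)(z), with coefficients decaying like
exp(-c k^2) ([gauss_kernel_le_shell]); these beat the exponential growth, and
summing over k bounds T from L^p(sigma) to L^p(w) ([gauss_operator_bounded]).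

Lower bound.  For cubes Q_d(s) and Q_d(t) of a small side d and for h >= 0
supported in the second one, multiply h exp(alpha |u|^2 / 2) by the phase
exp(-i alpha Im <s,u>).  For z in the first cube the phase of the integrand of
P is then almost constant in u, because Im <z - s, u - t> is of size d^2; there
is no cancellation, and |P f (z)| exp(-alpha |z|^2 / 2) is at least a constant
times int h ([phase_test_lower]).  Boundedness of P therefore gives
w(Q_d(s)) (int_(Q_d(t)) h)^p <= C int h^p sigma for all such pairs of small
cubes near a given cube Q of side r, and covering Q in both variables yields
w(Q) (int_Q h)^p <= C int_Q h^p sigma ([cube_test]).  Taking for h truncations
of sigma^(-1/(p-1)), or for p = 1 the indicator of a sublevel set of sigma,
gives the A_p condition ([A_const_le_of_bounded]).

All coverings by cubes are replaced by one averaging identity,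
  int_u int_(Q_r(u)) F = r^(2n) int F     ([integral_cube_average]),
a consequence of the Tonelli theorem and the symmetry of the relation
u in Q_r(z).  Weights and functions that are only Lebesgue measurable are
replaced at the end by Borel representatives, every notion involved being
given by integrals. *)

(** * Integrals of functions that need not be measurable *)

Section nonneg_integral.
Context d (T : measurableType d) (R : realType) (mu : {measure set T -> \bar R}).
Implicit Types (f g : T -> \bar R) (D : set T).
Local Open Scope ereal_scope.
Import HBNNSimple.

(** The integral of a nonnegative function is a supremum over the simple
functions below it.  Cutting such a simple function off on a null set does not
change its integral, so monotonicity holds for arbitrary f and g; it applies
to P f without first proving that P f is measurable. *)
Lemma ae_ge0_le_integralW D f g :
  (forall x, D x -> 0 <= f x) -> (forall x, D x -> 0 <= g x) ->
  {ae mu, forall x, D x -> f x <= g x} ->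
  \int[mu]_(x in D) f x <= \int[mu]_(x in D) g x.
Proof.
move=> f0 g0 [N [mN N0 fgN]].
have p0 (h : T -> \bar R) : (forall x, D x -> 0 <= h x) -> forall x, 0 <= (h \_ D) x.
  by move=> h0 x; rewrite patchE; case: ifPn => // /set_mem /h0.
rewrite (integral_mkcond D f) (integral_mkcond D g).
rewrite (ge0_integralTE _ (p0 _ f0)) (ge0_integralTE _ (p0 _ g0)).
apply: ge_ereal_sup => _ [h /= hf <-]; apply: ereal_sup_ubound => /=.
have mNC := measurableC mN.
exists (proj_nnsfun h mNC).
  move=> x; rewrite -mrestrict patchE; case: ifPn => xN; last exact: p0.
  apply: (le_trans (hf x)); rewrite !patchE; case: ifPn => // /set_mem Dx.
  have /(_ x) := fgN; move: (set_mem xN) => /= nNx H.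
  by apply: contrapT => nfg; apply: nNx; apply: H => /= /(_ Dx).
rewrite -2!integralT_nnsfun; apply: ae_eq_integral => //.
- by apply/measurable_EFinP.
- by apply/measurable_EFinP.
exists N; split => // x /= /not_implyP[_ xh]; apply: contrapT => nNx; apply: xh.
have : proj_nnsfun h mNC x = h x by rewrite -mrestrict patchE mem_set.
by move=> /= ->.
Qed.

Lemma ge0_le_integralW D f g :
  (forall x, D x -> 0 <= f x) -> (forall x, D x -> f x <= g x) ->
  \int[mu]_(x in D) f x <= \int[mu]_(x in D) g x.
Proof.
move=> f0 fg; apply: ae_ge0_le_integralW => //.
- by move=> x Dx; exact: le_trans (f0 _ Dx) (fg _ Dx).
- exact: aeW.
Qed.

Lemma ae_ge0_eq_integral D f g :
  (forall x, D x -> 0 <= f x) -> (forall x, D x -> 0 <= g x) ->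
  {ae mu, forall x, D x -> f x = g x} ->
  \int[mu]_(x in D) f x = \int[mu]_(x in D) g x.
Proof.
move=> f0 g0 fg; apply/eqP; rewrite eq_le !ae_ge0_le_integralW//;
  by apply: filterS fg => x /[apply] ->.
Qed.

Lemma ge0_subset_integralW (A B : set T) f : A `<=` B ->
  (forall x, B x -> 0 <= f x) ->
  \int[mu]_(x in A) f x <= \int[mu]_(x in B) f x.
Proof.
move=> AB f0; rewrite (integral_mkcond A) (integral_mkcond B).
apply: ge0_le_integralW => x _; rewrite !patchE.
  by case: ifPn => // /set_mem /AB /f0.
case: ifPn => [/set_mem /AB /mem_set -> //|_].
by case: ifPn => // /set_mem /f0.
Qed.

(** Both the positive and the negative part of f integrate to at most the right
hand side M, so their difference does too; when M is infinite there is nothing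
to prove. *)
Lemma abse_Rintegral_le (f : T -> R) :
  (`| \int[mu]_x f x |%R)%:E <= \int[mu]_x (`|f x|%R)%:E.
Proof.
set M := \int[mu]_x (`|f x|%R)%:E.
have M0 : 0 <= M by apply: integral_ge0 => x _; rewrite lee_fin.
have [->|] := eqVneq M +oo; first exact: leey.
rewrite -ltey => Moo.
rewrite /Rintegral integralE.
set a := integral _ _ _; set b := integral _ _ _.
have a0 : 0 <= a by exact: integral_ge0.
have b0 : 0 <= b by exact: integral_ge0.
have aM : a <= M.
  by apply: ge0_le_integralW => x _ //; rewrite funeposE /= ge_max !lee_fin ler_norm normr_ge0.
have bM : b <= M.
  by apply: ge0_le_integralW => x _ //; rewrite funenegE /= ge_max !lee_fin -normrN ler_norm normr_ge0.
have af : a \is a fin_num by rewrite ge0_fin_numE// (le_lt_trans aM).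
have bf : b \is a fin_num by rewrite ge0_fin_numE// (le_lt_trans bM).
have Mf : M \is a fin_num by rewrite ge0_fin_numE.
move: a0 b0 aM bM; rewrite -(fineK af) -(fineK bf) -(fineK Mf) -EFinN -EFinD /= !lee_fin.
by move=> a0 b0 aM bM; rewrite ler_norml; apply/andP; split; lra.
Qed.

End nonneg_integral.

(** * Cubes and averaging over cubes *)

Section cubes.
Variables (R : realType) (n : nat).
Local Notation Cn := (n.-tuple R[i]).
Local Notation v := (@lebesgue_Cn R n).
Implicit Types (z u s t : Cn) (r : R).

Lemma measurable_cube r z : 0 <= r -> measurable (cube r z).
Proof. by move=> /(lebesgue_Cn_cube z)[]. Qed.

Lemma volume_cube r z : 0 <= r -> v (cube r z) = (r ^+ (2 * n))%:E.
Proof. by move=> /(lebesgue_Cn_cube z)[]. Qed.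

(** Symmetry of the relation: this is what exchanges the two roles of a cube in
the averaging identity. *)
Lemma cubeC r z u : cube r z u <-> cube r u z.
Proof.
by split=> h j; have [h1 h2] := h j; split; rewrite -normrN -raddfN opprB.
Qed.

Lemma cube_trans r r' z u t : cube r z u -> cube r' u t -> cube (r + r') z t.
Proof.
move=> h h' j; have [h1 h2] := h j; have [h1' h2'] := h' j.
rewrite mulrDl !raddfB /= in h1 h2 h1' h2' *.
split.
  rewrite -(subrKA (complex.Re (tnth u j))) addrC.
  by apply: (le_trans (ler_normD _ _)); exact: lerD.
rewrite -(subrKA (complex.Im (tnth u j))) addrC.
by apply: (le_trans (ler_normD _ _)); exact: lerD.
Qed.

Lemma measurable_Re_tnth (j : 'I_n) : measurable_fun setT (fun z : Cn => complex.Re (tnth z j)).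
Proof. exact: measurableT_comp (@measurable_Re R) (measurable_tnth j). Qed.

Lemma measurable_Im_tnth (j : 'I_n) : measurable_fun setT (fun z : Cn => complex.Im (tnth z j)).
Proof. exact: measurableT_comp (@measurable_Im R) (measurable_tnth j). Qed.

Lemma measurable_cube_rel r : measurable [set x : Cn * Cn | cube r x.1 x.2].
Proof.
pose F j (x : Cn * Cn) := `|complex.Re (tnth x.2 j) - complex.Re (tnth x.1 j)|.
pose G j (x : Cn * Cn) := `|complex.Im (tnth x.2 j) - complex.Im (tnth x.1 j)|.
have mF j : measurable_fun setT (F j).
  apply: measurableT_comp; first exact: normr_measurable.
  apply: measurable_funB.
    exact: measurableT_comp (measurable_Re_tnth j) measurable_snd.
  exact: measurableT_comp (measurable_Re_tnth j) measurable_fst.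
have mG j : measurable_fun setT (G j).
  apply: measurableT_comp; first exact: normr_measurable.
  apply: measurable_funB.
    exact: measurableT_comp (measurable_Im_tnth j) measurable_snd.
  exact: measurableT_comp (measurable_Im_tnth j) measurable_fst.
rewrite (_ : [set _ | _] = \big[setI/setT]_(j < n)
    (F j @^-1` `]-oo, r / 2] `&` G j @^-1` `]-oo, r / 2])).
  apply: bigsetI_measurable => j _; apply: measurableI.
    by rewrite -[X in measurable X]setTI; apply: mF.
  by rewrite -[X in measurable X]setTI; apply: mG.
apply/seteqP; split => x /=.
  move=> h; apply: (big_ind (fun B : set (Cn * Cn) => B x)) => // j _.
  by have := h j; rewrite /F /G !raddfB /= !in_itv.
by move=> + j; rewrite (bigD1 j)//= => -[]; rewrite /F /G !raddfB /= !in_itv.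
Qed.

Local Open Scope ereal_scope.

(** A cube with variable centre is a section of a fixed measurable subset of the
product, to which the Tonelli theorem applies. *)
Lemma cube_patchE r (F : Cn -> \bar R) u z :
  (F \_ (cube r u)) z = ((F \o snd) \_ [set x : Cn * Cn | cube r x.1 x.2]) (u, z).
Proof. by rewrite !patchE; congr (if _ then _ else _); apply/idP/idP; rewrite !inE. Qed.

Section average.
Variables (r : R) (F : Cn -> \bar R).
Hypotheses (r0 : (0 <= r)%R) (mF : measurable_fun setT F) (F0 : forall z, 0 <= F z).

Let G := (F \o snd) \_ [set x : Cn * Cn | cube r x.1 x.2].

Let mG : measurable_fun setT G.
Proof.
apply/(measurable_restrictT _ (measurable_cube_rel r)).
apply: measurable_funS (measurableT_comp mF measurable_snd) => //.
Qed.

Let G0 x : 0 <= G x.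
Proof. by rewrite /G patchE; case: ifP => //= _; exact: F0. Qed.

Lemma measurable_cube_integral :
  measurable_fun setT (fun u => \int[v]_(z in cube r u) F z).
Proof.
rewrite (_ : (fun u => _) = fun u => \int[v]_z G (u, z)).
  exact: (measurable_fun_fubini_tonelli_F (m2 := v) G mG G0).
apply/funext => u; rewrite integral_mkcond; apply: eq_integral => z _.
exact: cube_patchE.
Qed.

(** Exchange the integrals: for fixed z the set of the u with z in Q_r(u) is
Q_r(z), of volume r^(2n). *)
Lemma integral_cube_average :
  \int[v]_u \int[v]_(z in cube r u) F z = (r ^+ (2 * n))%:E * \int[v]_z F z.
Proof.
transitivity (\int[v]_u \int[v]_z G (u, z)).
  apply: eq_integral => u _; rewrite integral_mkcond; apply: eq_integral => z _.
  exact: cube_patchE.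
rewrite (fubini_tonelli (m1 := v) (m2 := v) G mG G0) -ge0_integralZl//; last first.
  by rewrite lee_fin exprn_ge0.
apply: eq_integral => z _.
transitivity (\int[v]_(u in cube r z) F z).
  rewrite [RHS]integral_mkcond; apply: eq_integral => u _.
  rewrite /G !patchE /=; congr (if _ then _ else _).
  by apply/idP/idP; rewrite !inE /= => /cubeC.
rewrite integral_cst; last exact: measurable_cube.
by rewrite muleC; congr (_ * _); exact: volume_cube.
Qed.

End average.

(** Stands for a covering of the large cube by cubes of side d: average h
restricted to the large cube over the centres t; only t in the cube of side
rho + d contribute, hence the ratio of volumes as the covering number. *)
Lemma cube_covering_bound (rho d b : R) u (h : Cn -> \bar R) :
  (0 < d)%R -> (0 <= rho)%R -> (0 <= b)%R ->
  measurable_fun setT h -> (forall z, 0 <= h z) ->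
  (forall t, cube (rho + d) u t -> \int[v]_(z in cube d t) (h \_ (cube rho u)) z <= b%:E) ->
  \int[v]_(z in cube rho u) h z <= (((rho + d) / d) ^+ (2 * n) * b)%:E.
Proof.
move=> d0 rho0 b0 mh h0 hb.
have dn0 : (0 < d ^+ (2 * n))%R by rewrite exprn_gt0.
rewrite -(@lee_pmul2l _ ((d ^+ (2 * n))%:E))// ?fin_numE// ?lte_fin//.
rewrite integral_mkcond.
have mh' : measurable_fun setT (h \_ (cube rho u)).
  apply/(measurable_restrictT _ (measurable_cube u rho0)).
  exact: measurable_funS mh.
have h'0 z : 0 <= (h \_ (cube rho u)) z by rewrite patchE; case: ifP.
rewrite -(integral_cube_average (ltW d0) mh' h'0).
apply: (@le_trans _ _ (\int[v]_(t in cube (rho + d) u) b%:E)).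
  rewrite [X in _ <= X]integral_mkcond; apply: ge0_le_integralW => t _.
    by apply: integral_ge0 => z _; exact: h'0.
  rewrite patchE; case: ifPn => [/set_mem tu|]; first exact: hb.
  rewrite notin_setE => tu; rewrite integral0_eq// => z dz.
  rewrite patchE ifF//; apply/negbTE; rewrite notin_setE => uz; apply: tu.
  by apply: (cube_trans uz); apply/cubeC.
have rd0 : (0 <= rho + d)%R by rewrite addr_ge0// ltW.
rewrite integral_cst; last exact: measurable_cube.
rewrite [X in _ * X](volume_cube _ rd0) -!EFinM lee_fin expr_div_n.
rewrite le_eqVlt; apply/orP; left; apply/eqP.
by field; rewrite gt_eqF.
Qed.

End cubes.

(** * Young splitting as a substitute for the Hoelder inequality *)

Section young.
Variable R : realType.
Implicit Types (p x y l S B : R).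

(** Either x is at most l y, or x exceeds l y and then x^(p-1) exceeds
(l y)^(p-1).  At y = sigma^(-1/(p-1)) the second term is x^p sigma up to the
power of l. *)
Lemma young_split p x y l : 1 <= p -> 0 <= x -> 0 < y -> 0 < l ->
  x <= l * y + l `^ (1 - p) * (x `^ p * y `^ (1 - p)).
Proof.
move=> p1 x0 y0 l0; have ly0 : 0 < l * y by rewrite mulr_gt0.
have [xly|lyx] := leP x (l * y); first by rewrite ler_wpDr// !mulr_ge0// powR_ge0.
have x_gt0 : 0 < x by exact: lt_trans lyx.
apply: ler_wpDl; first exact: ltW.
rewrite mulrCA -powRM ?(ltW l0) ?(ltW y0)//.
rewrite -opprB powRN ler_pdivlMr ?powR_gt0//.
rewrite -[leRHS](mulr_powRB1 x0)// ?(lt_le_trans ltr01)// ler_pM2l//.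
by apply: ge0_ler_powR; rewrite ?nnegrE ?subr_ge0 ?(ltW ly0) ?(ltW lyx).
Qed.

Local Open Scope ereal_scope.

(** The optimal l makes the two terms comparable, l^p = B / S.  The loss of 2^p
compared with the Hoelder inequality is harmless here. *)
Lemma split_optimize p S B (x : \bar R) :
  (1 <= p)%R -> (0 < S)%R -> (0 <= B)%R -> 0 <= x ->
  (forall l, (0 < l)%R -> x <= (l * S + l `^ (1 - p) * B)%:E) ->
  x `^ p <= (2 `^ p * S `^ (p - 1) * B)%:E.
Proof.
move=> p1 S0 B0 x0 xl; have p0 : (0 < p)%R by exact: lt_le_trans p1.
have xf : x \is a fin_num.
  by rewrite ge0_fin_numE// (le_lt_trans (xl 1%R ltr01))// ltry.
move: x0 xl; rewrite -(fineK xf); move: (fine x) => y; rewrite lee_fin => y0 yl.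
have {yl}yl l : (0 < l -> y <= l * S + l `^ (1 - p) * B)%R.
  by move=> l0; have := yl l l0; rewrite lee_fin.
rewrite poweR_EFin lee_fin.
move: B0; rewrite le_eqVlt => /predU1P[B0|B0].
  have [->|yn0] := eqVneq y 0%R; first by rewrite powR0 ?gt_eqF// -B0 mulr0.
  have y_gt0 : (0 < y)%R by rewrite lt_neqAle eq_sym yn0.
  have := yl (y / (2 * S))%R; rewrite -B0 mulr0 addr0 divr_gt0 ?mulr_gt0//.
  move=> /(_ isT); rewrite invfM mulrA -mulrA mulVf ?gt_eqF// mulr1.
  by move=> ?; exfalso; lra.
(* this l equates the two terms of the splitting *)
pose l := ((B / S) `^ p^-1)%R.
have BS : (0 < B / S)%R by rewrite divr_gt0.
have l0 : (0 < l)%R by rewrite powR_gt0.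
have lp : (l `^ p = B / S)%R by rewrite /l -powRrM mulVf ?gt_eqF// powRr1// ltW.
have -> : (2 `^ p * S `^ (p - 1) * B = (2 * (l * S)) `^ p)%R.
  rewrite !powRM ?mulr_ge0 ?(ltW l0) ?(ltW S0)// lp -(mulr_powRB1 (ltW S0) p0).
  by field; rewrite gt_eqF.
apply: ge0_ler_powR; rewrite ?nnegrE ?(ltW p0)//.
  by rewrite !mulr_ge0// ltW.
apply: (le_trans (yl _ l0)); rewrite mulr_natl mulr2n lerD2l.
rewrite powRB ?(gt_eqF l0) ?implybT// lp powRr1 ?(ltW l0)//.
rewrite le_eqVlt; apply/orP; left; apply/eqP.
by field; rewrite !gt_eqF.
Qed.

End young.

Section integral_split.
Local Open Scope ereal_scope.

(** A Hoelder inequality in disguise: with k = sigma^(-1/(p-1)) and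
G = g^p sigma it bounds the integral of g by those of k and G.  k is allowed
the value +oo, which it takes where sigma vanishes. *)
Lemma integral_split_optimize d (T : measurableType d) (R : realType)
    (mu : {measure set T -> \bar R})
    (Q : set T) (p S : R) (g k G : T -> \bar R) : (1 <= p)%R -> (0 < S)%R ->
  measurable Q -> measurable_fun Q k -> measurable_fun Q G ->
  (forall x, Q x -> 0 <= g x) -> (forall x, Q x -> 0 <= k x) ->
  (forall x, Q x -> 0 <= G x) ->
  {ae mu, forall x, Q x -> forall l, (0 < l)%R -> g x <= l%:E * k x + (l `^ (1 - p))%:E * G x} ->
  \int[mu]_(x in Q) k x <= S%:E ->
  (\int[mu]_(x in Q) g x) `^ p <= (2 `^ p * S `^ (p - 1))%:E * \int[mu]_(x in Q) G x.
Proof.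
move=> p1 S0 mQ mk mG g0 k0 G0 gkG kS.
have C0 : (0 < 2 `^ p * S `^ (p - 1))%R by rewrite mulr_gt0 ?powR_gt0.
have iG0 : 0 <= \int[mu]_(x in Q) G x by exact: integral_ge0.
have [->|] := eqVneq (\int[mu]_(x in Q) G x) +oo.
  by rewrite gt0_muley ?lte_fin// leey.
rewrite -ltey -ge0_fin_numE// => Gf; rewrite -(fineK Gf).
apply: split_optimize => //; [exact: fine_ge0|exact: integral_ge0|move=> l l0].
have lp0 : (0 <= l `^ (1 - p))%R by exact: powR_ge0.
apply: (@le_trans _ _ (\int[mu]_(x in Q) (l%:E * k x + (l `^ (1 - p))%:E * G x))).
  apply: ae_ge0_le_integralW => //.
    move=> x Qx; apply: adde_ge0; apply: mule_ge0; rewrite ?lee_fin ?(ltW l0)//; [exact: k0|exact: G0].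
  by apply: filterS gkG => x gx Qx; exact: gx.
rewrite ge0_integralD//; first last.
- by apply: measurable_funeM.
- by move=> x Qx; apply: mule_ge0; [rewrite lee_fin|exact: G0].
- by apply: measurable_funeM.
- by move=> x Qx; apply: mule_ge0; [rewrite lee_fin ltW|exact: k0].
rewrite !ge0_integralZl// ?lee_fin ?(ltW l0)// EFinD EFinM [(_ * fine _)%:E]EFinM.
apply: leeD; first by rewrite lee_pmul2l ?lte_fin// fin_numE.
by rewrite fineK.
Qed.

(** Jensen inequality for a sum with coefficients of finite total mass. *)
Lemma nneseries_split_optimize (R : realType) (p S : R) (c : R^nat) (b : (\bar R)^nat) :
  (1 <= p)%R -> (0 < S)%R -> (forall k, (0 <= c k)%R) -> (forall k, 0 <= b k) ->
  \sum_(k <oo) (c k)%:E <= S%:E ->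
  (\sum_(k <oo) (c k)%:E * b k) `^ p <=
    (2 `^ p * S `^ (p - 1))%:E * \sum_(k <oo) (c k)%:E * b k `^ p.
Proof.
move=> p1 S0 c0 b0 cS; have p0 : (0 < p)%R by exact: lt_le_trans p1.
have C0 : (0 < 2 `^ p * S `^ (p - 1))%R by rewrite mulr_gt0 ?powR_gt0.
have cb0 k : 0 <= (c k)%:E * b k by rewrite mule_ge0 ?lee_fin.
have cbp0 k : 0 <= (c k)%:E * b k `^ p by rewrite mule_ge0 ?lee_fin ?poweR_ge0.
have sum0 : 0 <= \sum_(k <oo) (c k)%:E * b k `^ p by apply: nneseries_ge0 => k _ _.
have [->|] := eqVneq (\sum_(k <oo) (c k)%:E * b k `^ p) +oo.
  by rewrite gt0_muley ?lte_fin// leey.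
rewrite -ltey -ge0_fin_numE// => Gf; rewrite -(fineK Gf).
apply: split_optimize => //; [exact: fine_ge0|exact: nneseries_ge0|move=> l l0].
have lp0 : (0 < l `^ (1 - p))%R by exact: powR_gt0.
apply: (@le_trans _ _ (\sum_(k <oo) (l%:E * (c k)%:E + (l `^ (1 - p))%:E * ((c k)%:E * b k `^ p)))).
  apply: lee_nneseries => k _ //.
  rewrite (muleC l%:E) muleCA -ge0_muleDr ?lee_fin ?(ltW l0)//; last first.
    by rewrite mule_ge0 ?poweR_ge0// lee_fin ltW.
  apply: lee_wpmul2l; first by rewrite lee_fin.
  move: (b k) (b0 k) => [y| |]//; rewrite ?lee_fin => y0.

    by have := young_split p1 y0 ltr01 l0; rewrite powR1 !mulr1.
  by rewrite poweRyr ?gt_eqF// gt0_muley ?lte_fin// addey.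
rewrite nneseriesD; first last.
- by move=> k _ _; rewrite mule_ge0// lee_fin ltW.
- by move=> k _ _; rewrite mule_ge0 ?lee_fin ?(ltW l0).
rewrite !nneseriesZl//; last by move=> k _; rewrite lee_fin.
rewrite EFinD EFinM [(_ * fine _)%:E]EFinM.
apply: leeD; first by rewrite lee_pmul2l ?lte_fin// fin_numE.
by rewrite fineK.
Qed.

End integral_split.

(** * Growth of a doubling weight *)

Section doubling_growth.
Variables (R : realType) (n : nat).
Local Notation Cn := (n.-tuple R[i]).
Local Notation v := (@lebesgue_Cn R n).
Implicit Types (z u s t : Cn) (r D : R) (w : Cn -> R).

Lemma cube0_eq u t : cube 0 u t -> t = u.
Proof.
move=> h; apply: eq_from_tnth => j; have [] := h j.
rewrite mul0r !normr_le0 !raddfB /= !subr_eq0.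
by case: (tnth t j) (tnth u j) => a b [c d] /= /eqP -> /eqP ->.
Qed.

(** The point s divides the segment from t to u in the ratio 1 : k. *)
Lemma cube_interpolate (k : nat) r u t : cube (k.+1%:R * r) u t ->
  exists2 s, cube (k%:R * r) u s & cube r s t.
Proof.
move=> h; pose c : R := k.+1%:R^-1.
have c0 : 0 < c by rewrite invr_gt0.
have kc : k%:R = k.+1%:R * (1 - c).
  by rewrite mulrBr mulfV ?pnatr_eq0// mulr1 -natr1 addrK.
have c1 : 0 <= 1 - c by rewrite subr_ge0 invf_le1// ler1n.
pose s : Cn := [tuple
  ((complex.Re (tnth t j) + c * (complex.Re (tnth u j) - complex.Re (tnth t j))) +i*
   (complex.Im (tnth t j) + c * (complex.Im (tnth u j) - complex.Im (tnth t j)))) | j < n].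
have H (x y : R) : `|y - x| <= k.+1%:R * r / 2 ->
    `|(y + c * (x - y)) - x| <= k%:R * r / 2 /\ `|y - (y + c * (x - y))| <= r / 2.
  move=> xy; split.
    have -> : (y + c * (x - y)) - x = (1 - c) * (y - x) by ring.
    rewrite normrM ger0_norm// kc -[k.+1%:R * _]mulrC -!mulrA.
    by rewrite ler_wpM2l// !mulrA.
  have -> : y - (y + c * (x - y)) = c * (y - x) by ring.
  rewrite normrM ger0_norm ?(ltW c0)// /c ler_pdivrMl//.
  by rewrite mulrA.
exists s => j; have [h1 h2] := h j; rewrite !raddfB /= in h1 h2 *;
  rewrite !tnth_mktuple /=.
  by split; [have [] := H _ _ h1|have [] := H _ _ h2].
by split; [have [] := H _ _ h1|have [] := H _ _ h2].
Qed.

Lemma cube_exhaust r z u : 0 < r -> exists k : nat, cube (k%:R * r) z u.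
Proof.
move=> r0.
pose M : R := \sum_(j < n) (`|complex.Re (tnth u j - tnth z j)| +
                            `|complex.Im (tnth u j - tnth z j)|).
have M0 : 0 <= M by apply: sumr_ge0 => j _; rewrite addr_ge0.
pose k := (Num.truncn (M / (r / 2))).+1.
have kM : M <= k%:R * r / 2.
  rewrite -mulrA -ler_pdivrMr ?divr_gt0// ltW//.
  exact: truncnS_gt.
have jM j : `|complex.Re (tnth u j - tnth z j)| + `|complex.Im (tnth u j - tnth z j)| <= M.
  by rewrite /M (bigD1 j)//= lerDl sumr_ge0// => i _; rewrite addr_ge0.
exists k => j; split; apply: (le_trans _ kM); apply: (le_trans _ (jM j)).
  by rewrite lerDl.
by rewrite lerDr.
Qed.

Local Open Scope ereal_scope.

Lemma wmass_ge0 w E : (forall z, (0 <= w z)%R) -> 0 <= wmass w E.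
Proof. by move=> w0; apply: integral_ge0 => z _; rewrite lee_fin. Qed.

Lemma le_wmass w (E F : set Cn) : (forall z, (0 <= w z)%R) -> E `<=` F ->
  wmass w E <= wmass w F.
Proof. by move=> w0 EF; apply: ge0_subset_integralW => // z _; rewrite lee_fin. Qed.

(** Walk from u to t in k steps of size r / 2; at each step the new cube of side
r lies in the double of the next one. *)
Lemma doubling_chain r D w (k : nat) u t : (0 < r)%R -> (forall z, (0 <= w z)%R) ->
  doubling r D w -> cube (k%:R * r) u t ->
  wmass w (cube r u) <= (D ^+ k)%:E * wmass w (cube r t).
Proof.
move=> r0 w0 [D1 Dw]; have D0 : (0 <= D)%R by exact: le_trans ler01 D1.
elim: k t => [|k IH] t.
  by rewrite mul0r => /cube0_eq ->; rewrite expr0 mul1e.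
move=> /cube_interpolate[s us st].
apply: (le_trans (IH _ us)); rewrite exprSr EFinM -muleA.
apply: lee_wpmul2l; first by rewrite lee_fin exprn_ge0.
apply: le_trans (Dw t); apply: le_wmass => // y sy.
rewrite mulr2n mulrDl !mul1r.
by apply: cube_trans sy; apply/cubeC.
Qed.

Lemma doubling_mass_gt0 r D w z t : (0 < r)%R -> (forall z, (0 <= w z)%R) ->
  doubling r D w -> 0 < wmass w (cube r z) -> 0 < wmass w (cube r t).
Proof.
move=> r0 w0 dw wz; have [k zt] := cube_exhaust z t r0.
have := lt_le_trans wz (doubling_chain r0 w0 dw zt).
by rewrite !lt0e wmass_ge0// andbT => /andP[+ _]; apply: contra_neq => ->; rewrite mule0.
Qed.

End doubling_growth.

(** * The A_p condition on one cube *)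

Section A_local.
Variables (R : realType) (n : nat).
Local Notation Cn := (n.-tuple R[i]).
Local Notation v := (@lebesgue_Cn R n).
Implicit Types (z u s t : Cn) (r D p a : R) (w sigma : Cn -> R).

(** The weights of the problem up to null sets: a Borel representative is what
the Tonelli theorem can work with. *)
Definition borel_weight w : Prop :=
  [/\ forall z, 0 <= w z, measurable_fun setT w
    & forall z r, 0 < r -> (wmass w (cube r z) < +oo)%E].

Local Open Scope ereal_scope.

Lemma inv_poweRE (x q : R) : (0 <= x)%R -> (0 < q)%R ->
  ((x%:E)^-1 `^ q) = if x == 0%R then +oo else (x `^ (- q))%:E.
Proof.
move=> x0 q0; rewrite /inve; case: eqP => [_|/eqP xn0]; first by rewrite poweRyr ?gt_eqF.
by rewrite poweR_EFin -powR_inv1// -powRrM mulN1r.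
Qed.

Lemma measurable_inv_poweR sigma (q : R) : (forall z, (0 <= sigma z)%R) -> (0 < q)%R ->
  measurable_fun setT sigma -> measurable_fun setT (fun u => ((sigma u)%:E)^-1 `^ q).
Proof.
move=> s0 q0 ms.
rewrite (_ : (fun u => _) = fun u => if sigma u == 0%R then +oo else (sigma u `^ (- q))%:E).
  apply: measurable_fun_ifT => //.
  - exact: measurable_fun_eqr.
  - apply/measurable_EFinP; exact: (measurableT_comp (measurable_powR (- q)) ms).
by apply/funext => u; exact: inv_poweRE.
Qed.

Lemma poweR_le_root (x : \bar R) (y p : R) : (0 < p)%R -> 0 <= x -> (0 <= y)%R ->
  x `^ p <= y%:E -> x <= (y `^ p^-1)%:E.
Proof.
move=> p0 x0 y0 xy.
have -> : x = (x `^ p) `^ p^-1 by rewrite -poweRrM mulfV ?gt_eqF// poweRe1.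
rewrite -poweR_EFin; apply: gt0_ler_poweR => //.
- by rewrite invr_ge0 ltW.
- by rewrite in_itv /= leey poweR_ge0.
- by rewrite in_itv /= leey lee_fin y0.
Qed.

Lemma average_cube r t (F : Cn -> \bar R) : (0 < r)%R ->
  average (cube r t) F = ((r ^+ (2 * n))^-1)%:E * \int[v]_(z in cube r t) F z.
Proof.
move=> r0; rewrite /average [X in X^-1 * _](volume_cube t (ltW r0)) /inve.
by rewrite gt_eqF// exprn_gt0.
Qed.

Lemma volume_Cn_gt0 : 0 < v [set: Cn].
Proof.
pose z0 : Cn := [tuple 0%R | j < n].
apply: (@lt_le_trans _ _ (v (cube 1 z0))).
  by rewrite [ltRHS](volume_cube z0 ler01) lte_fin exprn_gt0.
by apply: le_measure; rewrite ?inE//; exact: measurable_cube.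
Qed.

(** For p = 1 bounding the term of the supremum on one cube means bounding
sigma from below almost everywhere there.  At a point where sigma vanishes its
inverse is +oo, and the lower bound fails there too because w has positive
mass on the cube. *)
Lemma A1_term_leP r w sigma a t : (0 < r)%R -> (0 <= a)%R ->
  (forall z, 0 <= sigma z)%R -> 0 < wmass w (cube r t) -> wmass w (cube r t) < +oo ->
  average (cube r t) (EFin \o w) *
    Lnorm v +oo ((fun u => ((sigma u)%:E)^-1) \_ (cube r t)) <= a%:E <->
  {ae v, forall u, cube r t u -> (fine (wmass w (cube r t)) <= a * r ^+ (2 * n) * sigma u)%R}.
Proof.
move=> r0 a0 s0 W0 Woo; have V0 : (0 < r ^+ (2 * n))%R by rewrite exprn_gt0.
rewrite average_cube// -/(wmass w _).
have Wf : wmass w (cube r t) \is a fin_num by rewrite ge0_fin_numE// ltW.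
move: W0; rewrite -(fineK Wf) lte_fin; move: (fine _) => W W0.
rewrite unlock volume_Cn_gt0 -EFinM.
have m0 : (0 < (r ^+ (2 * n))^-1 * W)%R by rewrite mulr_gt0 ?invr_gt0.
have -> : (((r ^+ (2 * n))^-1 * W)%:E * ess_sup v (abse \o (fun u => (sigma u)%:E^-1) \_ (cube r t)) <= a%:E) =
    (ess_sup v (abse \o (fun u => (sigma u)%:E^-1) \_ (cube r t)) <= (a / ((r ^+ (2 * n))^-1 * W))%:E).
  by rewrite EFinM -lee_pdivlMl// muleC.
have key x : (0 < x)%R -> (x^-1 <= a / ((r ^+ (2 * n))^-1 * W))%R = (W <= a * r ^+ (2 * n) * x)%R.
  move=> x0; rewrite (_ : (a / _ = a * r ^+ (2 * n) / W)%R); last first.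
    by field; rewrite !gt_eqF.
  by rewrite ler_pdivlMr// mulrC ler_pdivrMr.
rewrite -(rwP ess_supP); split; apply: filterS => u /=; rewrite patchE.
  move=> + tu; rewrite mem_set// /inve; case: eqP => // /eqP su.
  have s_gt0 : (0 < sigma u)%R by rewrite lt_neqAle eq_sym su s0.
  by rewrite abse_EFin lee_fin ger0_norm ?invr_ge0// key.
case: ifPn => [/set_mem tu /(_ tu) H|_ _]; last first.
  by rewrite abse0 lee_fin divr_ge0// ltW.
rewrite /inve; case: eqP H => [->|/eqP su H].
  by rewrite mulr0 leNgt W0.
have s_gt0 : (0 < sigma u)%R by rewrite lt_neqAle eq_sym su s0.
by rewrite abse_EFin lee_fin ger0_norm ?invr_ge0// key.
Qed.

(** Here p / p' = p - 1 and p' / p = 1 / (p - 1), so the term on one cube is a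
bound for the integral of the dual weight. *)
Lemma Ap_term_leP r p w sigma a t : (0 < r)%R -> (1 < p)%R -> (0 <= a)%R ->
  0 < wmass w (cube r t) -> wmass w (cube r t) < +oo ->
  average (cube r t) (EFin \o w) *
    average (cube r t) (fun u => ((sigma u)%:E)^-1 `^ (conj_exponent p / p)) `^ (p / conj_exponent p)
     <= a%:E <->
  \int[v]_(u in cube r t) (((sigma u)%:E)^-1 `^ (p - 1)^-1) <=
   (r ^+ (2 * n) * (a * r ^+ (2 * n) / fine (wmass w (cube r t))) `^ (p - 1)^-1)%:E.
Proof.
move=> r0 p1 a0 W0 Woo; have V0 : (0 < r ^+ (2 * n))%R by rewrite exprn_gt0.
have q0 : (0 < p - 1)%R by rewrite subr_gt0.
have p0 : (0 < p)%R by exact: lt_trans p1.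
have -> : (conj_exponent p / p = (p - 1)^-1)%R.
  by rewrite /conj_exponent; field; rewrite !gt_eqF.
have -> : (p / conj_exponent p = p - 1)%R.
  by rewrite /conj_exponent; field; rewrite !gt_eqF.
rewrite !average_cube// -/(wmass w _).
have Wf : wmass w (cube r t) \is a fin_num by rewrite ge0_fin_numE// ltW.
move: W0; rewrite -(fineK Wf) lte_fin; move: (fine _) => W W0 /=.
set I := integral _ _ _.
have I0 : 0 <= I by apply: integral_ge0 => u _; exact: poweR_ge0.
have m0 : (0 < (r ^+ (2 * n))^-1 * W)%R by rewrite mulr_gt0 ?invr_gt0.
rewrite -EFinM -lee_pdivlMl// -EFinM.
have aW0 : (0 <= a * r ^+ (2 * n) / W)%R by rewrite divr_ge0 ?mulr_ge0 ?(ltW V0) ?(ltW W0).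
have -> : (((r ^+ (2 * n))^-1 * W)^-1 * a = a * r ^+ (2 * n) / W)%R.
  by field; rewrite ?gt_eqF.
have VI0 : 0 <= (r ^+ (2 * n))^-1%:E * I by rewrite mule_ge0// lee_fin invr_ge0 ltW.
rewrite [X in _ <-> _ <= X]EFinM -lee_pdivrMl//.
split.
  by apply: poweR_le_root.
move=> H; have := @gt0_ler_poweR R (p - 1) (ltW q0) ((r ^+ (2 * n))^-1%:E * I)
  ((a * r ^+ (2 * n) / W) `^ (p - 1)^-1)%:E.
rewrite !in_itv /= !leey VI0 lee_fin powR_ge0 /= => /(_ isT isT H) /le_trans; apply.
by rewrite -powRrM mulVf ?gt_eqF// powRr1.
Qed.

End A_local.

(** * From the A_p condition to weighted averages *)

Section sufficiency.
Variables (R : realType) (n : nat).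
Local Notation Cn := (n.-tuple R[i]).
Local Notation v := (@lebesgue_Cn R n).
Implicit Types (z u s t : Cn).
Local Open Scope ereal_scope.

Section local.
Variables (p r a : R) (sigma w : Cn -> R).
Hypotheses (p1 : (1 <= p)%R) (r0 : (0 < r)%R) (a0 : (0 < a)%R).
Hypotheses (hs : borel_weight sigma) (hw : borel_weight w).
Hypothesis hA : A_const p r w sigma <= a%:E.

Let p0 : (0 < p)%R. Proof. exact: lt_le_trans p1. Qed.
Let V := (r ^+ (2 * n))%R.
Let V0 : (0 < V)%R. Proof. exact: exprn_gt0. Qed.
Let s0 z : (0 <= sigma z)%R. Proof. by have [] := hs. Qed.
Let w0 z : (0 <= w z)%R. Proof. by have [] := hw. Qed.
Let ms : measurable_fun setT sigma. Proof. by have [] := hs. Qed.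
Let mw : measurable_fun setT w. Proof. by have [] := hw. Qed.
Let wfin z : wmass w (cube r z) < +oo. Proof. by have [_ _ ->] := hw. Qed.

Lemma measurable_powR_weight (g : Cn -> R) (Q : set Cn) : measurable_fun setT g ->
  measurable_fun Q (fun u => (g u `^ p * sigma u)%:E).
Proof.
move=> mg; apply/measurable_EFinP; apply: (@measurable_funS _ _ _ _ setT) => //.
apply: measurable_funM => //; exact: (measurableT_comp (measurable_powR p) mg).
Qed.

(** On a cube of side r the A_p condition is a test inequality: for p > 1 split
g against the dual weight, for p = 1 use the pointwise lower bound for sigma. *)
Lemma A_const_local (g : Cn -> R) t : (forall u, (0 <= g u)%R) -> measurable_fun setT g ->
  0 < wmass w (cube r t) ->
  wmass w (cube r t) * (\int[v]_(u in cube r t) (g u)%:E) `^ p <=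
  (2 `^ p * V `^ p * a)%:E * \int[v]_(u in cube r t) (g u `^ p * sigma u)%:E.
Proof.
move=> g0 mg W0; have mQ := measurable_cube t (ltW r0).
have Wf : wmass w (cube r t) \is a fin_num by rewrite ge0_fin_numE// wmass_ge0.
have gs0 u : 0 <= (g u `^ p * sigma u)%:E by rewrite lee_fin mulr_ge0// powR_ge0.
move: hA; rewrite /A_const; case: eqVneq => [pE|pn1] hAt.
  have /A1_term_leP : average (cube r t) (EFin \o w) *
      Lnorm v +oo ((fun u => ((sigma u)%:E)^-1) \_ (cube r t)) <= a%:E.
    by apply: le_trans hAt; apply: ereal_sup_ubound; exists t.
  move=> /(_ r0 (ltW a0) s0 W0 (wfin t)); rewrite -(fineK Wf) /=.
  have W0' : (0 <= fine (wmass w (cube r t)))%R by rewrite fine_ge0// ltW.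
  have pw x : (0 <= x -> x `^ p = x)%R by rewrite pE; exact: powRr1.
  have pwe (x : \bar R) : 0 <= x -> x `^ p = x by rewrite pE; exact: poweRe1.
  rewrite pwe; last by apply: integral_ge0 => u _; rewrite lee_fin.
  rewrite !pw ?(ltW V0)// => H.
  rewrite -ge0_integralZl//; last first.
  - by move=> u _; rewrite lee_fin.
  - by apply/measurable_EFinP; exact: measurable_funS mg.
  rewrite -ge0_integralZl//; first last.
  - by rewrite lee_fin !mulr_ge0 ?(ltW V0) ?(ltW a0).
  - exact: measurable_powR_weight.
  apply: ae_ge0_le_integralW => //.
  - by move=> u _; rewrite mule_ge0// lee_fin.
  - by move=> u _; rewrite mule_ge0// lee_fin !mulr_ge0 ?(ltW V0) ?(ltW a0).
  apply: filterS H => u H Qu; rewrite pw// -!EFinM lee_fin.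
  have := H Qu; rewrite -/V => {}H.
  rewrite mulrC; apply: (@le_trans _ _ (g u * (a * V * sigma u))%R).
    exact: ler_wpM2l.
  have : (0 <= V * a * (g u * sigma u))%R by rewrite !mulr_ge0 ?(ltW V0) ?(ltW a0).
  lra.
have {pn1}p1' : (1 < p)%R by rewrite lt_neqAle eq_sym pn1.
have q0 : (0 < p - 1)%R by rewrite subr_gt0.
have /Ap_term_leP : average (cube r t) (EFin \o w) *
    average (cube r t) (fun u => ((sigma u)%:E)^-1 `^ (conj_exponent p / p)) `^ (p / conj_exponent p)
     <= a%:E.
  by apply: le_trans hAt; apply: ereal_sup_ubound; exists t.
move=> /(_ r0 p1' (ltW a0) W0 (wfin t)); rewrite -/V.
move: W0; rewrite -(fineK Wf) /=; move: (fine _) => W; rewrite lte_fin => W0.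
set S := (V * _)%R => IS.
have S0 : (0 < S)%R by rewrite mulr_gt0// powR_gt0// divr_gt0// mulr_gt0.
have Sp : (S `^ (p - 1) = V `^ p * a / W)%R.
  rewrite /S powRM ?(ltW V0) ?powR_ge0// -powRrM mulVf ?gt_eqF//.
  rewrite powRr1; last by rewrite divr_ge0 ?mulr_ge0// ?(ltW V0) ?(ltW a0) ?(ltW W0).
  by rewrite -(mulr_powRB1 (ltW V0) p0); ring.
apply: (@le_trans _ _ (W%:E * ((2 `^ p * S `^ (p - 1))%:E * \int[v]_(u in cube r t) (g u `^ p * sigma u)%:E))).
  apply: lee_wpmul2l; first by rewrite lee_fin ltW.
  apply: integral_split_optimize S0 mQ _ _ _ _ _ _ IS => //.
  - apply: (@measurable_funS _ _ _ _ setT) => //.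
    by apply: measurable_inv_poweR => //; rewrite invr_gt0.
  - exact: measurable_powR_weight.
  - by move=> u _; rewrite lee_fin.
  - by move=> u _; exact: poweR_ge0.
  apply: aeW => u _ l l0; rewrite inv_poweRE ?invr_gt0//; case: eqP => [_|/eqP su].
    by rewrite gt0_muley ?lte_fin// addye ?leey// -EFinM.
  have s_gt0 : (0 < sigma u)%R by rewrite lt_neqAle eq_sym su s0.
  have := young_split p1 (g0 u) (powR_gt0 (- (p - 1)^-1) s_gt0) l0.
  rewrite -[X in (_ * (_ * X))%R]powRrM (_ : - (p - 1)^-1 * (1 - p) = 1)%R; last first.
    by field; rewrite gt_eqF.
  by rewrite powRr1// -!EFinM -EFinD lee_fin.
rewrite muleA -EFinM Sp le_eqVlt; apply/orP; left; apply/eqP; congr (_%:E * _).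
by field; rewrite gt_eqF.
Qed.

(** The three factors come from the doubling chain, the covering number of a
cube of side k r by cubes of side r, and the local inequality. *)
Definition growth_const (D : R) (k : nat) : R :=
  D ^+ k.+1 * (k.+1%:R ^+ (2 * n)) `^ p * (2 `^ p * V `^ p).

(** Cover the cube of side k r by cubes of side r and apply the local inequality
to each, comparing the mass of w there with its mass on the central cube. *)
Lemma A_const_enlarged D (k : nat) (g : Cn -> R) u : doubling r D w ->
  (forall u, (0 <= g u)%R) -> measurable_fun setT g ->
  \int[v]_z (g z `^ p * sigma z)%:E < +oo -> 0 < wmass w (cube r u) ->
  wmass w (cube r u) * (\int[v]_(z in cube (k%:R * r) u) (g z)%:E) `^ p <=
  (growth_const D k * a)%:E *
    \int[v]_(z in cube (k%:R * r) u) (g z `^ p * sigma z)%:E.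
Proof.
move=> dw g0 mg goo W0; set Q := cube (k%:R * r) u.
have kr0 : (0 <= k%:R * r)%R by rewrite mulr_ge0// ltW.
have mQ : measurable Q by exact: measurable_cube.
have D0 : (0 < D)%R by case: dw => D1 _; exact: lt_le_trans D1.
have Wf : wmass w (cube r u) \is a fin_num by rewrite ge0_fin_numE// wmass_ge0.
have gs0 z : 0 <= (g z `^ p * sigma z)%:E by rewrite lee_fin mulr_ge0// powR_ge0.
have B0 : 0 <= \int[v]_(z in Q) (g z `^ p * sigma z)%:E by exact: integral_ge0.
have Bf : \int[v]_(z in Q) (g z `^ p * sigma z)%:E \is a fin_num.
  rewrite ge0_fin_numE//; apply: le_lt_trans goo.
  exact: ge0_subset_integralW.
have W0' : (0 < fine (wmass w (cube r u)))%R by rewrite fine_gt0// W0 ltey_eq Wf.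
have B0' := fine_ge0 B0.
set W := fine (wmass w _) in W0'; set B := fine _ in B0'.
pose c := (D ^+ k.+1 * (2 `^ p * V `^ p) * a * B / W)%R.
have c0 : (0 <= c)%R.
  rewrite /c divr_ge0 ?(ltW W0')// !mulr_ge0// ?powR_ge0// ?(ltW a0)//.
  by rewrite exprn_ge0// ltW.
pose b := (c `^ p^-1)%R.
have bp : (b `^ p = c)%R by rewrite /b -powRrM mulVf ?gt_eqF// powRr1.
have /(_ n r b u (EFin \o g) r0 kr0 (powR_ge0 _ _)) := @cube_covering_bound R _ (k%:R * r).
move=> H.
have {}H : \int[v]_(z in Q) (g z)%:E <= (((k%:R * r + r) / r) ^+ (2 * n) * b)%:E.
  apply: H.
  - exact/measurable_EFinP.
  - by move=> z; rewrite lee_fin.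
  move=> t tu.
  have Wt0 : 0 < wmass w (cube r t) by exact: doubling_mass_gt0 dw W0.
  (* g is cut off outside Q, so that no integral over a small cube exceeds the
     one over Q *)
  pose g1 := (g \_ Q)%R.
  have g10 z : (0 <= g1 z)%R by rewrite /g1 patchE; case: ifP.
  have mg1 : measurable_fun setT g1.
    by apply/(measurable_restrictT _ mQ); exact: measurable_funS mg.
  have -> : \int[v]_(z in cube r t) ((EFin \o g) \_ Q) z = \int[v]_(z in cube r t) (g1 z)%:E.
    by apply: eq_integral => z _; rewrite /g1 !patchE; case: ifP.
  have I0 : 0 <= \int[v]_(z in cube r t) (g1 z)%:E.
    by apply: integral_ge0 => z _; rewrite lee_fin.
  apply: poweR_le_root => //.
  rewrite /c EFinM lee_pdivlMr// muleC (fineK Wf).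
  have tu' : cube (k.+1%:R * r) u t by rewrite -natr1 mulrDl mul1r.
  have := doubling_chain r0 w0 dw tu' => /(lee_wpmul2r (poweR_ge0 (\int[v]_(z in cube r t) (g1 z)%:E) p)).
  move=> /le_trans; apply; rewrite -!mulrA EFinM -muleA; apply: lee_wpmul2l.
    by rewrite lee_fin exprn_ge0// ltW.
  apply: (le_trans (A_const_local _ _ _)) => //.
  rewrite !mulrA [X in _ <= X]EFinM; apply: lee_wpmul2l.
    by rewrite lee_fin !mulr_ge0 ?powR_ge0 ?(ltW a0).
  rewrite (fineK Bf) [X in _ <= X]integral_mkcond.
  rewrite [X in X <= _](_ : _ = \int[v]_(z in cube r t)
     ((fun z => (g z `^ p * sigma z)%:E) \_ Q) z); last first.
    apply: eq_integral => z _; rewrite /g1 !patchE; case: ifP => // _.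
    by rewrite powR0 ?gt_eqF// mul0r.
  by apply: ge0_subset_integralW => // z _; rewrite patchE; case: ifP.
have k1 : ((k%:R * r + r) / r = k.+1%:R)%R by rewrite -natr1; field; rewrite gt_eqF.
rewrite k1 in H.
rewrite -(fineK Wf) -/W -(fineK Bf) -/B.
apply: (@le_trans _ _ (W%:E * ((k.+1%:R ^+ (2 * n) * b) `^ p)%:E)).
  apply: lee_wpmul2l; first by rewrite lee_fin ltW.
  rewrite -poweR_EFin; apply: gt0_ler_poweR => //.
  - exact: ltW.
  - by rewrite in_itv /= leey integral_ge0// => z _; rewrite lee_fin.
  - by rewrite in_itv /= leey lee_fin mulr_ge0// ?exprn_ge0// powR_ge0.
rewrite powRM ?exprn_ge0 ?powR_ge0// bp /c -!EFinM lee_fin /growth_const.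
rewrite le_eqVlt; apply/orP; left; apply/eqP.
by field; rewrite gt_eqF.
Qed.

Lemma measurable_cube_integral_fin (g : Cn -> R) (rho : R) : (0 <= rho)%R ->
  (forall u, (0 <= g u)%R) -> measurable_fun setT g ->
  measurable_fun setT (fun z => \int[v]_(u in cube rho z) (g u)%:E).
Proof.
move=> rho0 g0 mg; apply: measurable_cube_integral => //.
exact/measurable_EFinP.
Qed.

(** Average over cubes of side r: for z in Q_r(u) the cube of side k r about z
lies in that of side (k + 1) r about u, so the inner integral is controlled by
w(Q_r(u)) times an integral over the latter. *)
Lemma weighted_cube_average D (k : nat) (g : Cn -> R) : doubling r D w ->
  (forall z, 0 < wmass w (cube r z)) ->
  (forall u, (0 <= g u)%R) -> measurable_fun setT g ->
  \int[v]_z (g z `^ p * sigma z)%:E < +oo ->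
  \int[v]_z ((\int[v]_(u in cube (k%:R * r) z) (g u)%:E) `^ p * (w z)%:E) <=
  (growth_const D k.+1 * a * k.+1%:R ^+ (2 * n))%:E *
    \int[v]_z (g z `^ p * sigma z)%:E.
Proof.
move=> dw W0 g0 mg goo.
have kr0 : (0 <= k%:R * r)%R by rewrite mulr_ge0// ltW.
have k1r0 : (0 <= k.+1%:R * r)%R by rewrite mulr_ge0// ltW.
have D0 : (0 < D)%R by case: dw => D1 _; exact: lt_le_trans D1.
have gs0 z : 0 <= (g z `^ p * sigma z)%:E by rewrite lee_fin mulr_ge0// powR_ge0.
have mb := measurable_cube_integral_fin kr0 g0 mg.
have E0 : (0 <= growth_const D k.+1 * a)%R.
  apply: mulr_ge0; last exact: ltW.
  by apply: mulr_ge0; apply: mulr_ge0; rewrite ?powR_ge0// exprn_ge0// ltW.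
set F := fun z => _ `^ p * _.
have mF : measurable_fun setT F.
  apply: emeasurable_funM; first exact: measurableT_comp (measurable_poweR p) mb.
  exact/measurable_EFinP.
have F0 z : 0 <= F z by rewrite /F mule_ge0 ?poweR_ge0// lee_fin.
rewrite -(@lee_pmul2l _ V%:E)// ?fin_numE//.
rewrite -(integral_cube_average (ltW r0) mF F0).
apply: (@le_trans _ _ (\int[v]_u ((growth_const D k.+1 * a)%:E *
    \int[v]_(z in cube (k.+1%:R * r) u) (g z `^ p * sigma z)%:E))).
  apply: ge0_le_integralW => u _; first exact: integral_ge0.
  apply: le_trans (A_const_enlarged k.+1 dw g0 mg goo (W0 u)).
  set c := (X in _ <= _ * X).
  have -> : wmass w (cube r u) * c = \int[v]_(z in cube r u) (c * (w z)%:E).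
    rewrite muleC ge0_integralZl//; first last.
    - exact: poweR_ge0.
    - by move=> z _; rewrite lee_fin.
    - by apply/measurable_EFinP; exact: measurable_funS mw.
    - exact: measurable_cube (ltW r0).
  apply: ge0_le_integralW => z zu //; apply: lee_wpmul2r; first by rewrite lee_fin.
  apply: gt0_ler_poweR.
  - exact: ltW.
  - by rewrite in_itv /= leey integral_ge0// => y _; rewrite lee_fin.
  - by rewrite in_itv /= leey integral_ge0// => y _; rewrite lee_fin.
  apply: ge0_subset_integralW => [y zy|y _]; last by rewrite lee_fin.
  by rewrite -natr1 mulrDl mul1r addrC; exact: cube_trans zy.
have mgs : measurable_fun setT (fun z => (g z `^ p * sigma z)%:E).
  exact: measurable_powR_weight.
rewrite ge0_integralZl//; first last.
- by move=> z _; exact: integral_ge0.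
- exact: measurable_cube_integral.
rewrite integral_cube_average// !muleA -!EFinM.
rewrite le_eqVlt; apply/orP; left; apply/eqP; congr (_%:E * _).
by rewrite /V exprMn; ring.
Qed.

End local.
End sufficiency.

(** * Decomposition of the Gaussian kernel into cubes *)

Section shells.
Variables (R : realType) (n : nat).
Local Notation Cn := (n.-tuple R[i]).
Local Notation v := (@lebesgue_Cn R n).
Implicit Types (z u : Cn) (alpha r p D : R).

(** Completing the square: -c x^2 + b x is at most b^2 / (4 c). *)
Lemma gauss_beats_exp (c b : R) : 0 < c -> exists2 K : R, 0 < K &
  forall k : nat, expR (- c * k.-1%:R ^+ 2) * expR (b * k.+2%:R) <= K / (2 ^ k.+1)%:R.
Proof.
move=> c0.
(* the additional 1 absorbs the powers of 2, which are at most those of e *)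
pose b' := `|b| + 1.
have b'0 : 0 <= b' by rewrite addr_ge0.
exists (expR (b' ^+ 2 / (4 * c) + 3 * b')); first exact: expR_gt0.
move=> k; rewrite ler_pdivlMr ?ltr0n ?expn_gt0//.
have k1 : k%:R <= k.-1%:R + 1 :> R by rewrite natr1 ler_nat; case: k.
have pow2 : (2 ^ k.+1)%:R <= expR k.+2%:R :> R.
  rewrite natrX (@le_trans _ _ (expR k.+1%:R))//; last by rewrite ler_expR ler_nat.
  rewrite -[X in expR X]mulr1 expRM_natl ler_pXn2r ?nnegrE ?expR_ge0//.
  by have := expR_ge1Dx (1 : R).
apply: (@le_trans _ _ (expR (- c * k.-1%:R ^+ 2) * expR (b * k.+2%:R) * expR k.+2%:R)).
  by rewrite ler_wpM2l// mulr_ge0 ?expR_ge0.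
rewrite -!expRD ler_expR.
have -> : k.+2%:R = k%:R + 2 :> R by rewrite -addn2 natrD.
set x : R := k.-1%:R in k1 *.
have x0 : 0 <= x by rewrite /x.
have bb : b + 1 <= b' by rewrite /b' lerD2r ler_norm.
have h1 : b * (k%:R + 2) + (k%:R + 2) <= b' * (x + 3).
  rewrite -[X in _ + X]mul1r -mulrDl.
  apply: (@le_trans _ _ (b' * (k%:R + 2))); first by rewrite ler_wpM2r// addr_ge0.
  by rewrite ler_wpM2l//; lra.
have h2 : - c * x ^+ 2 + b' * x <= b' ^+ 2 / (4 * c).
  rewrite ler_pdivlMr ?mulr_gt0//.
  have := sqr_ge0 (2 * c * x - b'); nra.
lra.
Qed.

Definition gauss_kernel alpha z u : R :=
  expR (- (alpha / 2) * \sum_(j < n) normc (tnth z j - tnth u j) ^+ 2).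

(** The predecessor is truncated: the cubes with k = 0 and k = 1 both get the
coefficient 1. *)
Definition shell_coef alpha r (k : nat) : R := expR (- (alpha * r ^+ 2 / 8) * k.-1%:R ^+ 2).

Lemma normc_sqrE (x : R[i]) : normc x ^+ 2 = complex.Re x ^+ 2 + complex.Im x ^+ 2.
Proof. by case: x => a b /=; rewrite sqr_sqrtr// addr_ge0// sqr_ge0. Qed.

(** Take the smallest k with u in Q_(k r)(z).  When k > 0, some real coordinate
of z - u exceeds (k - 1) r / 2. *)
Lemma gauss_kernel_le_shell alpha r z u : 0 < alpha -> 0 < r ->
  exists2 k, cube (k%:R * r) z u & gauss_kernel alpha z u <= shell_coef alpha r k.
Proof.
move=> al0 r0; have [k0 zk0] := cube_exhaust z u r0.
have ex : exists k, `[< cube (k%:R * r) z u >] by exists k0; exact/asboolP.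
case: (ex_minnP ex) => k /asboolP zk kmin; exists k => //.
rewrite /gauss_kernel /shell_coef ler_expR.
have S0 : 0 <= \sum_(j < n) normc (tnth z j - tnth u j) ^+ 2.
  by apply: sumr_ge0 => j _; rewrite sqr_ge0.
case: k zk kmin => [|k] zk kmin.
  rewrite /= expr0n /= mulr0 mulNr oppr_le0 mulr_ge0// divr_ge0// ltW//.
rewrite -pred_Sn.
have nk : ~ cube (k%:R * r) z u by move=> /asboolP /kmin; rewrite ltnn.
have [j hj] : exists j, (k%:R * r / 2) ^+ 2 <= normc (tnth z j - tnth u j) ^+ 2.
  apply: contrapT => nj; apply: nk => j.
  have {nj} : ~ (k%:R * r / 2) ^+ 2 <= normc (tnth z j - tnth u j) ^+ 2.
    by move=> H; apply: nj; exists j.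
  move=> /negP; rewrite -ltNge normc_sqrE => H.
  have kr : 0 <= k%:R * r / 2 by rewrite divr_ge0// mulr_ge0// ltW.
  split; rewrite -(ler_pXn2r (n := 2))// ?nnegrE// real_normK ?num_real//;
    rewrite -[X in X ^+ 2]opprK sqrrN -raddfN opprB; apply: le_trans (ltW H).
    by rewrite lerDl sqr_ge0.
  by rewrite lerDr sqr_ge0.
have hS : (k%:R * r / 2) ^+ 2 <= \sum_(j < n) normc (tnth z j - tnth u j) ^+ 2.
  apply: (le_trans hj); rewrite (bigD1 j)//= lerDl.
  by apply: sumr_ge0 => i _; rewrite sqr_ge0.
rewrite !mulNr lerN2.
apply: (@le_trans _ _ (alpha / 2 * (k%:R * r / 2) ^+ 2)).
  by rewrite le_eqVlt; apply/orP; left; apply/eqP; field.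
by rewrite ler_wpM2l// divr_ge0// ltW.
Qed.

Local Open Scope ereal_scope.

Lemma nneseries_ge_term (f : (\bar R)^nat) k : (forall i, 0 <= f i) -> f k <= \sum_(i <oo) f i.
Proof.
move=> f0; rewrite (nneseriesD1 (n := k))//.
by rewrite leeDl// nneseries_ge0.
Qed.

Lemma gauss_integral_le_shells alpha r (g : Cn -> R) z : (0 < alpha)%R -> (0 < r)%R ->
  (forall u, (0 <= g u)%R) -> measurable_fun setT g ->
  \int[v]_u (g u * gauss_kernel alpha z u)%:E <=
  \sum_(k <oo) (shell_coef alpha r k)%:E * \int[v]_(u in cube (k%:R * r) z) (g u)%:E.
Proof.
move=> al0 r0 g0 mg.
have kr0 k : (0 <= k%:R * r)%R by rewrite mulr_ge0// ltW.
pose f k u := (shell_coef alpha r k)%:E * ((EFin \o g) \_ (cube (k%:R * r) z)) u.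
have p0 k u : 0 <= ((EFin \o g) \_ (cube (k%:R * r) z)) u.
  by rewrite patchE; case: ifP => // _; rewrite lee_fin.
have f0 k u : 0 <= f k u by rewrite mule_ge0// lee_fin expR_ge0.
have mp k : measurable_fun setT ((EFin \o g) \_ (cube (k%:R * r) z)).
  apply/(measurable_restrictT _ (measurable_cube _ (kr0 k))).
  by apply/measurable_EFinP; exact: measurable_funS mg.
have mf k : measurable_fun setT (f k) by exact: measurable_funeM.
apply: (@le_trans _ _ (\int[v]_u \sum_(k <oo) f k u)).
  apply: ge0_le_integralW => u _; first by rewrite lee_fin mulr_ge0// expR_ge0.
  have [k zk gk] := gauss_kernel_le_shell z u al0 r0.
  apply: le_trans (nneseries_ge_term k (fun i => f0 i u)).
  by rewrite /f patchE mem_set//= -EFinM lee_fin mulrC ler_wpM2r.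
rewrite integral_nneseries//.
rewrite le_eqVlt; apply/orP; left; apply/eqP.
apply: eq_eseriesr => k _; rewrite ge0_integralZl//.
  by rewrite -integral_mkcond.
by rewrite lee_fin expR_ge0.
Qed.

(** All factors of the growth constant are at most exponential in k, so they are
absorbed by the Gaussian decay. *)
Lemma shell_series_bounded alpha r p D : (0 < alpha)%R -> (0 < r)%R -> (1 <= p)%R ->
  (1 <= D)%R -> exists2 K : R, (0 < K)%R &
  \sum_(k <oo) (shell_coef alpha r k)%:E <= K%:E /\
  \sum_(k <oo) (shell_coef alpha r k * (growth_const n p r D k.+1 * k.+1%:R ^+ (2 * n)))%:E <= K%:E.
Proof.
move=> al0 r0 p1 D1; have D0 : (0 < D)%R by exact: lt_le_trans D1.
have p0 : (0 < p)%R by exact: lt_le_trans p1.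
have c0 : (0 < alpha * r ^+ 2 / 8)%R by rewrite divr_gt0// mulr_gt0// exprn_gt0.
pose b : R := (ln D + (2 * n)%:R * p + (2 * n)%:R)%R.
have lnD0 : (0 <= ln D)%R by exact: ln_ge0.
have b0 : (0 <= b)%R by rewrite /b !addr_ge0// mulr_ge0// ltW.
have [K K0 hK] := gauss_beats_exp b c0.
pose M := (2 `^ p * (r ^+ (2 * n)) `^ p)%R.
have M0 : (0 <= M)%R by rewrite mulr_ge0 ?powR_ge0.
have sum_le (x : R^nat) (C : R) : (0 <= C)%R -> (forall k, (0 <= x k)%R) ->
    (forall k, (x k <= C * (K / (2 ^ k.+1)%:R))%R) -> \sum_(k <oo) (x k)%:E <= (C * K)%:E.
  move=> C0 x0 xk; apply: le_trans (epsilon_trick0 xpredT (mulr_ge0 C0 (ltW K0))).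
  by apply: lee_nneseries => k *; rewrite lee_fin -?mulrA.
have nle (m : nat) : (m%:R <= expR m%:R :> R)%R.
  by apply: le_trans (expR_ge1Dx _); rewrite lerDr.
exists (K + M * K)%R; first by rewrite ltr_pwDl// mulr_ge0// ltW.
split.
  apply: (@le_trans _ _ (1 * K)%:E); last by rewrite lee_fin mul1r lerDl mulr_ge0// ltW.
  apply: sum_le => // k; first exact: expR_ge0.
  rewrite mul1r; apply: le_trans (hK k).
  rewrite /shell_coef ler_peMr ?expR_ge0// -expR0 ler_expR mulr_ge0//.
apply: (@le_trans _ _ (M * K)%:E); last by rewrite lee_fin lerDr ltW.
have g0 k : (0 <= growth_const n p r D k * k%:R ^+ (2 * n))%R.
  rewrite mulr_ge0 ?exprn_ge0//.
  by apply: mulr_ge0; apply: mulr_ge0; rewrite ?powR_ge0// exprn_ge0// ltW.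
apply: sum_le => // k.
  apply: mulr_ge0; first exact: expR_ge0.
  apply: mulr_ge0; last by rewrite exprn_ge0.
  by apply: mulr_ge0; apply: mulr_ge0; rewrite ?powR_ge0// exprn_ge0// ltW.
apply: (@le_trans _ _ (M * (shell_coef alpha r k * expR (b * k.+2%:R)))%R); last first.
  by apply: ler_wpM2l => //; exact: hK.
rewrite [leRHS]mulrCA; apply: ler_wpM2l; first exact: expR_ge0.
rewrite /growth_const -/M -mulrA mulrC -mulrA; apply: ler_wpM2l => //.
have -> : expR (b * k.+2%:R) = (expR k.+2%:R ^+ (2 * n) * (D ^+ k.+2 * (expR k.+2%:R ^+ (2 * n)) `^ p))%R.
  rewrite /b !mulrDl expRD expRD -[X in (X ^+ k.+2)%R](@lnK _ D) ?posrE//.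
  rewrite -!expRM_natl /powR gt_eqF ?expR_gt0// expRK.
  rewrite [(_ * expR (_ * _))%R]mulrC; congr (_ * (expR _ * expR _))%R; ring.
apply: ler_pM.
- exact: exprn_ge0.
- by rewrite mulr_ge0 ?powR_ge0// exprn_ge0// ltW.
- apply: lerXn2r; rewrite ?nnegrE ?expR_ge0//.
  by apply: le_trans (nle _); rewrite ler_nat.
apply: ler_wpM2l; first by rewrite exprn_ge0// ltW.
apply: ge0_ler_powR; rewrite ?nnegrE ?exprn_ge0 ?expR_ge0 ?(ltW p0)//.
by apply: lerXn2r; rewrite ?nnegrE ?expR_ge0.
Qed.

End shells.

(** * The Gaussian convolution between weighted spaces *)

Section operator.
Variables (R : realType) (n : nat).
Local Notation Cn := (n.-tuple R[i]).
Local Notation v := (@lebesgue_Cn R n).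
Implicit Types (z u : Cn) (alpha r p D : R).
Local Open Scope ereal_scope.

(** By doubling a weight that misses one cube misses them all; the A_p condition
says nothing about sigma then. *)
Lemma weight_ae0 r D (w : Cn -> R) z : (0 < r)%R -> borel_weight w -> doubling r D w ->
  wmass w (cube r z) = 0 -> {ae v, forall u, w u = 0%R}.
Proof.
move=> r0 [w0 mw wfin] dw wz.
have W0 t : wmass w (cube r t) = 0.
  have [//|W] := eqVneq (wmass w (cube r t)) 0.
  have : 0 < wmass w (cube r t) by rewrite lt0e W wmass_ge0.
  by move=> /(doubling_mass_gt0 z r0 w0 dw); rewrite wz ltxx.
have mwE : measurable_fun setT (EFin \o w) by exact/measurable_EFinP.
have w0E u : 0 <= (EFin \o w) u by rewrite lee_fin.
have := integral_cube_average (ltW r0) mwE w0E.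
rewrite integral0_eq; last by move=> t _; exact: W0.
move=> /esym/eqP; rewrite mule_eq0 eqe gt_eqF ?exprn_gt0//= => /eqP I0.
have : \int[v]_x `|(EFin \o w) x| = 0.
  by rewrite -[RHS]I0; apply: eq_integral => u _; rewrite gee0_abs.
move=> /(ae_eq_integral_abs _ measurableT mwE); apply: filterS => u /(_ I) /=.
by move=> [].
Qed.

(** T is the majorant given by the cubes of side k r.  Unlike the projection, it
is visibly measurable, and finite almost everywhere for w dv. *)
Lemma gauss_operator_bounded alpha r p D :
  (0 < alpha)%R -> (0 < r)%R -> (1 <= p)%R -> (1 <= D)%R -> exists2 K : R, (0 < K)%R &
  forall (sigma w g : Cn -> R) (a : R),
    borel_weight sigma -> borel_weight w -> doubling r D w -> (0 < a)%R ->
    A_const p r w sigma <= a%:E ->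
    (forall u, (0 <= g u)%R) -> measurable_fun setT g ->
    \int[v]_z (g z `^ p * sigma z)%:E < +oo ->
  exists T : Cn -> \bar R, [/\ measurable_fun setT T, forall z, 0 <= T z,
    forall z, \int[v]_u (g u * gauss_kernel alpha z u)%:E <= T z &
    \int[v]_z (T z `^ p * (w z)%:E) <= (K * a)%:E * \int[v]_z (g z `^ p * sigma z)%:E].
Proof.
move=> al0 r0 p1 D1.
have [S S0 [S1 S2]] := shell_series_bounded n al0 r0 p1 D1.
have C0 : (0 < 2 `^ p * S `^ (p - 1))%R by rewrite mulr_gt0 ?powR_gt0.
exists (2 `^ p * S `^ (p - 1) * S)%R; first exact: mulr_gt0.
move=> sigma w g a hs hw dw a0 hA g0 mg goo.
have kr0 k : (0 <= k%:R * r)%R by rewrite mulr_ge0// ltW.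
pose b k z := \int[v]_(u in cube (k%:R * r) z) (g u)%:E.
have b0 k z : 0 <= b k z by apply: integral_ge0 => u _; rewrite lee_fin.
have mb k : measurable_fun setT (b k) by exact: measurable_cube_integral_fin.
pose c k := shell_coef alpha r k.
have c0 k : (0 <= c k)%R by exact: expR_ge0.
pose T z := \sum_(k <oo) (c k)%:E * b k z.
have [w0 mw wfin] := hw; have [s0 ms _] := hs.
have gs0 z : 0 <= (g z `^ p * sigma z)%:E by rewrite lee_fin mulr_ge0// powR_ge0.
have G0 : 0 <= \int[v]_z (g z `^ p * sigma z)%:E by exact: integral_ge0.
have cb0 k z : 0 <= (c k)%:E * b k z by rewrite mule_ge0// lee_fin.
exists T; split.
- apply: (@ge0_emeasurable_sum _ _ _ _ _ xpredT) => [k z _ _|k _]; first exact: cb0.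
  exact: measurable_funeM.
- by move=> z; apply: nneseries_ge0.
- by move=> z; exact: gauss_integral_le_shells.
have [allW|/existsNP[z0 nW]] := pselect (forall z, 0 < wmass w (cube r z)); last first.
  have wz : wmass w (cube r z0) = 0.
    apply/eqP; apply: contrapT => /negP Wn; apply: nW.
    by rewrite lt0e Wn wmass_ge0.
  rewrite (_ : \int[v]_z _ = 0).
    by rewrite mule_ge0// lee_fin !mulr_ge0 ?powR_ge0 ?(ltW S0) ?(ltW a0).
  rewrite -[RHS](integral0 v setT); apply: ae_ge0_eq_integral => //.
    by move=> z _; rewrite mule_ge0 ?poweR_ge0// lee_fin.
  by apply: filterS (weight_ae0 r0 hw dw wz) => u -> _; rewrite mule0.
have mbp k : measurable_fun setT (fun z => b k z `^ p).
  exact: measurableT_comp (measurable_poweR p) (mb k).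
have mwE : measurable_fun setT (EFin \o w) by exact/measurable_EFinP.
pose F k z := (c k)%:E * (b k z `^ p * (w z)%:E).
have F0 k z : 0 <= F k z by rewrite !mule_ge0 ?poweR_ge0// lee_fin.
have mF0 k : measurable_fun setT (fun z => b k z `^ p * (w z)%:E).
  exact: emeasurable_funM.
have mF k : measurable_fun setT (F k) by exact: measurable_funeM.
apply: (@le_trans _ _ (\int[v]_z ((2 `^ p * S `^ (p - 1))%:E * \sum_(k <oo) F k z))).
  apply: ge0_le_integralW => z _; first by rewrite mule_ge0 ?poweR_ge0// lee_fin.
  apply: (@le_trans _ _ (((2 `^ p * S `^ (p - 1))%:E * \sum_(k <oo) (c k)%:E * b k z `^ p) * (w z)%:E)).
    apply: lee_wpmul2r; first by rewrite lee_fin.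
    exact: nneseries_split_optimize.
  rewrite -muleA; apply: lee_wpmul2l; first by rewrite lee_fin ltW.
  rewrite muleC -nneseriesZl; last by move=> k *; rewrite mule_ge0 ?poweR_ge0// lee_fin.
  by apply: lee_nneseries => k *; rewrite /F 1?muleCA 1?[(w z)%:E * _]muleC// !mule_ge0 ?poweR_ge0 ?lee_fin.
rewrite ge0_integralZl//; first last.
- by rewrite lee_fin ltW.
- by move=> z _; apply: nneseries_ge0.
- by apply: ge0_emeasurable_sum.
rewrite integral_nneseries//.
have Gf : \int[v]_z (g z `^ p * sigma z)%:E \is a fin_num by rewrite ge0_fin_numE.
suff H : \sum_(k <oo) \int[v]_z F k z <= (S * a)%:E * \int[v]_z (g z `^ p * sigma z)%:E.
  apply: (@le_trans _ _ ((2 `^ p * S `^ (p - 1))%:E *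
      ((S * a)%:E * \int[v]_z (g z `^ p * sigma z)%:E))).
    by apply: lee_wpmul2l => //; rewrite lee_fin ltW.
  by rewrite muleA -EFinM mulrA.
have G0' := fine_ge0 G0.
rewrite EFinM -muleA -[X in a%:E * X](fineK Gf) -EFinM.
set aG := (a * _)%R; have aG0 : (0 <= aG)%R by rewrite mulr_ge0// ltW.
pose x k := (c k * (growth_const n p r D k.+1 * k.+1%:R ^+ (2 * n)))%R.
have x0 k : (0 <= x k)%R.
  apply: mulr_ge0 => //; apply: mulr_ge0; last by rewrite exprn_ge0.
  have D0 : (0 <= D)%R by exact: le_trans D1.
  by apply: mulr_ge0; apply: mulr_ge0; rewrite ?powR_ge0// exprn_ge0.
apply: (@le_trans _ _ (aG%:E * \sum_(k <oo) (x k)%:E)); last first.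
  by rewrite muleC EFinM; apply: lee_wpmul2r => //; rewrite lee_fin.
rewrite -nneseriesZl; last by move=> k *; rewrite lee_fin.
apply: lee_nneseries => k *; first exact: integral_ge0.
rewrite /F ge0_integralZl//; first last.
- by rewrite lee_fin.
- by move=> z _; rewrite mule_ge0 ?poweR_ge0// lee_fin.
apply: (@le_trans _ _ ((c k)%:E * ((growth_const n p r D k.+1 * a * k.+1%:R ^+ (2 * n))%:E *
    \int[v]_z (g z `^ p * sigma z)%:E))).
  apply: lee_wpmul2l; first by rewrite lee_fin.
  exact: weighted_cube_average.
rewrite -(fineK Gf) -!EFinM lee_fin le_eqVlt; apply/orP; left; apply/eqP.
by rewrite /aG /x; ring.
Qed.

End operator.

(** * The modulus of the Fock kernel *)

Section fock_identities.
Variables (R : realType) (n : nat).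
Local Notation Cn := (n.-tuple R[i]).
Local Notation v := (@lebesgue_Cn R n).
Implicit Types (z u : Cn) (alpha r p D : R) (f : Cn -> R[i]) (w : Cn -> R).

(** The p-th power of the norm of f is the integral of the p-th power of this
function against the weight. *)
Definition fock_mod alpha f u : R := normc (f u) * expR (- (alpha / 2) * sqnorm u).

Lemma normc_ge0 (x : R[i]) : 0 <= normc x.
Proof. by case: x => a b; exact: sqrtr_ge0. Qed.

Lemma fock_mod_ge0 alpha f u : 0 <= fock_mod alpha f u.
Proof. by rewrite mulr_ge0 ?expR_ge0// normc_ge0. Qed.

Lemma expR_powR (x p : R) : expR x `^ p = expR (p * x).
Proof. by rewrite /powR gt_eqF ?expR_gt0// expRK. Qed.

Lemma fock_energyE p alpha w f :
  fock_energy p alpha w f = (\int[v]_z (fock_mod alpha f z `^ p * w z)%:E)%E.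
Proof.
apply: eq_integral => z _; congr (_ * _)%:E.
rewrite powRM ?normc_ge0 ?expR_ge0// expR_powR; congr (_ * expR _); by field.
Qed.

Lemma sqnorm_sub z u : \sum_(j < n) normc (tnth z j - tnth u j) ^+ 2 =
  sqnorm z + sqnorm u - 2 * complex.Re (inner z u).
Proof.
rewrite /inner raddf_sum /sqnorm mulr_sumr -big_split /= -sumrB.
apply: eq_bigr => j _.  rewrite !normc_sqrE.
by case: (tnth z j) (tnth u j) => a b [c d] /=; ring.
Qed.

Lemma normc_cexp (x : R[i]) : normc (cexp x) = expR (complex.Re x).
Proof.
rewrite /cexp /= !exprMn -mulrDr cos2Dsin2 mulr1 sqrtr_sqr.
by rewrite ger0_norm// expR_ge0.
Qed.

Lemma normc_real (x : R) : 0 <= x -> normc x%:C = x.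
Proof. by move=> x0; rewrite /= expr0n /= addr0 sqrtr_sqr ger0_norm. Qed.

Lemma gaussian_ge0 alpha u : 0 <= alpha -> 0 <= gaussian alpha u.
Proof. by move=> a0; rewrite mulr_ge0 ?expR_ge0// exprn_ge0// divr_ge0// pi_ge0. Qed.

(** The real part of 2 <z,u> is |z|^2 + |u|^2 - |z - u|^2. *)
Lemma expR_inner_factor alpha z u :
  expR (alpha * complex.Re (inner z u)) * expR (- alpha * sqnorm u) =
  expR (alpha / 2 * sqnorm z) * (expR (- (alpha / 2) * sqnorm u) * gauss_kernel alpha z u).
Proof. by rewrite /gauss_kernel sqnorm_sub -!expRD; congr expR; field. Qed.

Lemma Re_real_mul (x : R) (y : R[i]) : complex.Re (x%:C * y) = x * complex.Re y.
Proof. by case: y => a b /=; rewrite mul0r subr0. Qed.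

Lemma Im_real_mul (x : R) (y : R[i]) : complex.Im (x%:C * y) = x * complex.Im y.
Proof. by case: y => a b /=; rewrite mul0r addr0. Qed.

Lemma normc_fock_integrand alpha f z u : 0 <= alpha ->
  normc (fock_integrand alpha f z u) =
  (alpha / pi) ^+ n * expR (alpha / 2 * sqnorm z) * (fock_mod alpha f u * gauss_kernel alpha z u).
Proof.
move=> a0; rewrite /fock_integrand !normcM normc_real ?gaussian_ge0// normc_cexp Re_real_mul.
rewrite /gaussian /fock_mod [LHS](_ : _ = (alpha / pi) ^+ n * normc (f u) *
  (expR (alpha * complex.Re (inner z u)) * expR (- alpha * sqnorm u))); last by ring.
by rewrite expR_inner_factor; ring.
Qed.

Lemma measurable_normc f : measurable_fun setT f -> measurable_fun setT (fun u => normc (f u)).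
Proof.
move=> mf; rewrite (_ : (fun u => _) = fun u => Num.sqrt (complex.Re (f u) ^+ 2 + complex.Im (f u) ^+ 2)).
  apply: measurableT_comp.
    apply: continuous_measurable_fun; exact: sqrt_continuous.
  apply: measurable_funD; apply: measurable_funX.
    exact: measurableT_comp (@measurable_Re R) mf.
  exact: measurableT_comp (@measurable_Im R) mf.
by apply/funext => u; case: (f u).
Qed.

Lemma measurable_sqnorm : measurable_fun setT (@sqnorm R n).
Proof.
apply: measurable_sum => j; apply: measurable_funX; apply: measurable_normc.
exact: measurable_tnth.
Qed.

Lemma measurable_fock_mod alpha f : measurable_fun setT f -> measurable_fun setT (fock_mod alpha f).
Proof.
move=> mf; apply: measurable_funM; first exact: measurable_normc.
apply: measurableT_comp; first exact: measurable_expR.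
by apply: measurable_funM => //; exact: measurable_sqnorm.
Qed.

End fock_identities.

(** * The upper bound for the Fock projection *)

Section fock_energy.
Variables (R : realType) (n : nat).
Local Notation Cn := (n.-tuple R[i]).
Local Notation v := (@lebesgue_Cn R n).
Implicit Types (z u : Cn) (alpha r p D : R) (f : Cn -> R[i]).
Local Open Scope ereal_scope.

Lemma normr_Re_le (x : R[i]) : (`|complex.Re x| <= normc x)%R.
Proof.
rewrite -(ler_pXn2r (n := 2))// ?nnegrE ?normc_ge0// normc_sqrE.
by rewrite real_normK ?num_real// lerDl sqr_ge0.
Qed.

Lemma normr_Im_le (x : R[i]) : (`|complex.Im x| <= normc x)%R.
Proof.
rewrite -(ler_pXn2r (n := 2))// ?nnegrE ?normc_ge0// normc_sqrE.
by rewrite real_normK ?num_real// lerDr sqr_ge0.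
Qed.

Lemma normc_le_ReIm (x : R[i]) : (normc x <= `|complex.Re x| + `|complex.Im x|)%R.
Proof.
rewrite -(ler_pXn2r (n := 2))// ?nnegrE ?normc_ge0 ?addr_ge0// normc_sqrE.
rewrite sqrrD !real_normK ?num_real// -addrA [X in (_ <= _ + X)%R]addrC addrA lerDl.
by rewrite mulrn_wge0// mulr_ge0.
Qed.

Lemma normc_complex_integral_le (F : Cn -> R[i]) :
  (normc (complex_integral F))%:E <= 2%:E * \int[v]_u (normc (F u))%:E.
Proof.
apply: (@le_trans _ _ ((`|\int[v]_u complex.Re (F u)|%R)%:E + (`|\int[v]_u complex.Im (F u)|%R)%:E)).
  by rewrite -EFinD lee_fin; exact: (normc_le_ReIm (complex_integral F)).
have -> : (2%:E = 1%:E + 1%:E :> \bar R) by rewrite -EFinD.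
rewrite ge0_muleDl ?lee_fin// mul1e; apply: leeD.
  apply: (le_trans (abse_Rintegral_le _ _)); apply: ge0_le_integralW => u _.
    by rewrite lee_fin.
  by rewrite lee_fin; exact: normr_Re_le.
apply: (le_trans (abse_Rintegral_le _ _)); apply: ge0_le_integralW => u _.
  by rewrite lee_fin.
by rewrite lee_fin; exact: normr_Im_le.
Qed.

Lemma measurable_gauss_kernel alpha z : measurable_fun setT (gauss_kernel alpha z).
Proof.
apply: measurableT_comp; first exact: measurable_expR.
apply: measurable_funM => //.
rewrite (_ : (fun u => _) = fun u : Cn => (\sum_(j < n)
  ((complex.Re (tnth z j) - complex.Re (tnth u j)) ^+ 2 +
   (complex.Im (tnth z j) - complex.Im (tnth u j)) ^+ 2))%R); last first.
  by apply/funext => u; apply: eq_bigr => j _; rewrite normc_sqrE !raddfB.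
apply: measurable_sum => j; apply: measurable_funD; apply: measurable_funX;
  apply: measurable_funB => //.
  exact: measurable_Re_tnth.
exact: measurable_Im_tnth.
Qed.

Lemma integral_normc_fock_integrand alpha f z : (0 <= alpha)%R -> measurable_fun setT f ->
  \int[v]_u (normc (fock_integrand alpha f z u))%:E =
  ((alpha / pi) ^+ n * expR (alpha / 2 * sqnorm z))%:E *
   \int[v]_u (fock_mod alpha f u * gauss_kernel alpha z u)%:E.
Proof.
move=> a0 mf; rewrite -ge0_integralZl//.
- by apply: eq_integral => u _; rewrite normc_fock_integrand.
- apply/measurable_EFinP; apply: measurable_funM; first exact: measurable_fock_mod.
  exact: measurable_gauss_kernel.
- by move=> u _; rewrite lee_fin mulr_ge0 ?fock_mod_ge0// expR_ge0.
by rewrite lee_fin mulr_ge0 ?expR_ge0// exprn_ge0// divr_ge0// pi_ge0.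
Qed.

(** The factor 2 comes from bounding real and imaginary part separately. *)
Lemma fock_mod_proj_le alpha f z : (0 <= alpha)%R -> measurable_fun setT f ->
  (fock_mod alpha (fock_proj alpha f) z)%:E <=
  (2 * (alpha / pi) ^+ n)%:E * \int[v]_u (fock_mod alpha f u * gauss_kernel alpha z u)%:E.
Proof.
move=> a0 mf; rewrite /fock_mod EFinM.
apply: (@le_trans _ _ ((2%:E * \int[v]_u (normc (fock_integrand alpha f z u))%:E) *
    (expR (- (alpha / 2) * sqnorm z))%:E)).
  apply: lee_wpmul2r; first by rewrite lee_fin expR_ge0.
  exact: normc_complex_integral_le.
rewrite integral_normc_fock_integrand// -/(fock_mod alpha f _).
rewrite !muleA -EFinM muleAC -EFinM le_eqVlt; apply/orP; left; apply/eqP; congr (_%:E * _).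
have E : (expR (alpha / 2 * sqnorm z) * expR (- (alpha / 2) * sqnorm z) = 1)%R.
  by rewrite -expRD mulNr subrr expR0.
transitivity (2 * (alpha / pi) ^+ n * (expR (alpha / 2 * sqnorm z) * expR (- (alpha / 2) * sqnorm z)))%R.
  by ring.
by rewrite E mulr1.
Qed.

(** Absolute convergence fails only where the majorant T is infinite, a set of
w-measure zero because T^p is integrable for w dv. *)
Lemma fock_energy_proj_le alpha r p D :
  (0 < alpha)%R -> (0 < r)%R -> (1 <= p)%R -> (1 <= D)%R -> exists2 K : R, (0 < K)%R &
  forall (sigma w : Cn -> R) (a : R) (f : Cn -> R[i]),
    borel_weight sigma -> borel_weight w -> doubling r D w -> (0 < a)%R ->
    A_const p r w sigma <= a%:E -> measurable_fun setT f ->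
    fock_energy p alpha sigma f < +oo ->
    weight_ae w (fock_proj_cvg alpha f) /\
    fock_energy p alpha w (fock_proj alpha f) <= (K * a)%:E * fock_energy p alpha sigma f.
Proof.
move=> al0 r0 p1 D1; have p0 : (0 < p)%R by exact: lt_le_trans p1.
have [K K0 HK] := gauss_operator_bounded n al0 r0 p1 D1.
have C0 : (0 < 2 * (alpha / pi) ^+ n :> R)%R by rewrite mulr_gt0// exprn_gt0// divr_gt0// pi_gt0.
exists ((2 * (alpha / pi) ^+ n) `^ p * K)%R; first by rewrite mulr_gt0// powR_gt0.
move=> sigma w a f hs hw dw a0 hA mf; rewrite !fock_energyE => foo.
have [T [mT T0 gT HT]] := HK _ _ _ _ hs hw dw a0 hA (fock_mod_ge0 alpha f)
  (measurable_fock_mod alpha mf) foo.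
have [w0 mw _] := hw; have [s0 _ _] := hs.
have mwE : measurable_fun setT (EFin \o w) by exact/measurable_EFinP.
have F0 z : 0 <= T z `^ p * (w z)%:E by rewrite mule_ge0 ?poweR_ge0// lee_fin.
have mF : measurable_fun setT (fun z => T z `^ p * (w z)%:E).
  by apply: emeasurable_funM => //; exact: measurableT_comp (measurable_poweR p) mT.
split.
  pose N := T @^-1` [set +oo].
  have mN : measurable N by rewrite -[X in measurable X]setTI; exact: mT.
  exists N; split => //; last first.
    move=> z /= ncvg; rewrite /N /= ; apply: contrapT => /eqP; rewrite -ltey => Tz.
    apply: ncvg; rewrite /fock_proj_cvg integral_normc_fock_integrand//; last exact: ltW.
    have L0 : 0 <= \int[v]_u (fock_mod alpha f u * gauss_kernel alpha z u)%:E.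
      by apply: integral_ge0 => u _; rewrite lee_fin mulr_ge0 ?fock_mod_ge0// expR_ge0.
    have : \int[v]_u (fock_mod alpha f u * gauss_kernel alpha z u)%:E \is a fin_num.
      by rewrite ge0_fin_numE// (le_lt_trans (gT z)).
    by move=> /fineK <-; rewrite -EFinM ltry.
  have H : +oo * wmass w N <= \int[v]_z (T z `^ p * (w z)%:E).
    rewrite /wmass -ge0_integralZl//; first last.
    - by move=> z _; rewrite lee_fin.
    - exact: measurable_funS mwE.
    rewrite (eq_integral (fun z => T z `^ p * (w z)%:E)); last first.
      by move=> z; rewrite inE /N /= => ->; rewrite poweRyr ?gt_eqF.
    exact: ge0_subset_integralW.
  apply/eqP; apply: contrapT => /negP wN.
  move: H; rewrite gt0_mulye ?lt0e ?wN ?wmass_ge0// leye_eq => /eqP Hoo.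
  move: HT; rewrite Hoo leye_eq => /eqP.
  have G0 : 0 <= \int[v]_z (fock_mod alpha f z `^ p * sigma z)%:E.
    by apply: integral_ge0 => z _; rewrite lee_fin mulr_ge0// powR_ge0.
  by move: foo; rewrite -ge0_fin_numE// => /fineK <-.
apply: (@le_trans _ _ (((2 * (alpha / pi) ^+ n) `^ p)%:E * \int[v]_z (T z `^ p * (w z)%:E))).
  rewrite -ge0_integralZl//; last by rewrite lee_fin powR_ge0.
  apply: ge0_le_integralW => z _.
    by rewrite lee_fin mulr_ge0 ?powR_ge0.
  rewrite muleA EFinM; apply: lee_wpmul2r; first by rewrite lee_fin.
  rewrite -!poweR_EFin -poweRM// ?lee_fin ?(ltW C0)//.
  have H : (fock_mod alpha (fock_proj alpha f) z)%:E <= (2 * (alpha / pi) ^+ n)%:E * T z.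
    apply: (le_trans (fock_mod_proj_le _ (ltW al0) mf)).
    by apply: lee_wpmul2l => //; rewrite lee_fin ltW.
  apply: gt0_ler_poweR => //; first exact: ltW.
  - by rewrite in_itv /= leey lee_fin fock_mod_ge0.
  - by rewrite in_itv /= leey mule_ge0// lee_fin ltW.
rewrite -mulrA EFinM -muleA; apply: lee_wpmul2l => //.
by rewrite lee_fin powR_ge0.
Qed.

End fock_energy.

(** * Test functions with a phase *)

Section phase_test.
Variables (R : realType) (n : nat).
Local Notation Cn := (n.-tuple R[i]).
Local Notation v := (@lebesgue_Cn R n).
Implicit Types (z u s t : Cn) (alpha r p d : R) (h : Cn -> R).

Definition phase z u : R := complex.Im (inner z u).

Lemma phaseE z u : phase z u = \sum_(j < n)
  (complex.Im (tnth z j) * complex.Re (tnth u j) - complex.Re (tnth z j) * complex.Im (tnth u j)).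
Proof.
rewrite /phase /inner raddf_sum; apply: eq_bigr => j _.
by case: (tnth z j) (tnth u j) => a b [c d] /=; ring.
Qed.

(** The left hand side is the modulus of Im <z - s, u - t>: the phase is bilinear,
so it separates in z and u up to this term, quadratic in d. *)
Lemma phase_oscillation d s t z u : cube d s z -> cube d t u ->
  `|(phase z u - phase s u) - (phase z t - phase s t)| <= n%:R * (d ^+ 2 / 2).
Proof.
move=> sz tu; rewrite !phaseE -!sumrB.
apply: (le_trans (ler_norm_sum _ _ _)).
apply: (@le_trans _ _ (\sum_(j < n) (d ^+ 2 / 2))); last first.
  by rewrite sumr_const card_ord [leRHS]mulr_natl.
apply: ler_sum => j _; have [] := sz j; have [] := tu j; rewrite !raddfB /=.
case: (tnth z j) (tnth u j) (tnth s j) (tnth t j) => za zb [ua ub] [sa sb] [ta tb] /= h1 h2 h3 h4.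
rewrite [X in `|X|](_ : _ = (zb - sb) * (ua - ta) - (za - sa) * (ub - tb)); last by ring.
have dE : d ^+ 2 / 2 = d / 2 * (d / 2) + d / 2 * (d / 2) by field.
by rewrite dE; apply: (le_trans (ler_normB _ _)); rewrite !normrM lerD// ler_pM.
Qed.

Lemma gauss_kernel_ge (rho : R) alpha z u : 0 <= alpha -> cube rho z u ->
  expR (- (alpha / 2) * (n%:R * (rho ^+ 2 / 2))) <= gauss_kernel alpha z u.
Proof.
move=> a0 zu; rewrite /gauss_kernel ler_expR !mulNr lerN2 ler_wpM2l ?divr_ge0//.
apply: (@le_trans _ _ (\sum_(j < n) (rho ^+ 2 / 2))); last first.
  by rewrite sumr_const card_ord [leRHS]mulr_natl.
apply: ler_sum => j _; rewrite normc_sqrE; have [] := zu j; rewrite !raddfB /= => h1 h2.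
have rE : rho ^+ 2 / 2 = (rho / 2) ^+ 2 + (rho / 2) ^+ 2 by field.
have rho0 : 0 <= rho / 2 by exact: le_trans h1.
have sq (x : R) : `|x| <= rho / 2 -> x ^+ 2 <= (rho / 2) ^+ 2.
  by move=> hx; rewrite -[X in X <= _](real_normK (num_real x)) ler_pXn2r ?nnegrE.
by rewrite rE lerD// sq// distrC.
Qed.

(** The phase exp(-i alpha Im <s,u>) cancels the oscillation of the Fock kernel
exp(alpha <z,u>) in u for z near s. *)
Definition phase_test alpha s h u : R[i] :=
  (h u * expR (alpha / 2 * sqnorm u) * cos (alpha * phase s u)) +i*
  (- (h u * expR (alpha / 2 * sqnorm u) * sin (alpha * phase s u))).

Lemma fock_mod_phase_test alpha s h u : 0 <= h u -> fock_mod alpha (phase_test alpha s h) u = h u.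
Proof.
move=> h0; rewrite /fock_mod /= sqrrN !exprMn -mulrDr cos2Dsin2 mulr1 -exprMn sqrtr_sqr.
rewrite ger0_norm ?mulr_ge0 ?expR_ge0// -[LHS]mulrA -expRD.
by rewrite mulNr subrr expR0 mulr1.
Qed.

(** For h >= 0, the modulus of the integrand of P applied to
[phase_test alpha s h]. *)
Definition test_density alpha h z u : R :=
  (alpha / pi) ^+ n * expR (alpha / 2 * sqnorm z) * (h u * gauss_kernel alpha z u).

Lemma fock_integrand_phase_test alpha s h z u :
  fock_integrand alpha (phase_test alpha s h) z u =
  (test_density alpha h z u * cos (alpha * (phase z u - phase s u))) +i*
  (test_density alpha h z u * sin (alpha * (phase z u - phase s u))).
Proof.
rewrite /fock_integrand /phase_test /cexp Re_real_mul Im_real_mul -/(phase z u) /gaussian.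
have E : expR (alpha / 2 * sqnorm u) * (expR (alpha * complex.Re (inner z u)) * expR (- alpha * sqnorm u)) =
    expR (alpha / 2 * sqnorm z) * gauss_kernel alpha z u.
  rewrite expR_inner_factor mulrCA; congr (_ * _).
  by rewrite mulrA -expRD mulNr subrr expR0 mul1r.
have -> : test_density alpha h z u = (alpha / pi) ^+ n * h u * (expR (alpha / 2 * sqnorm u) *
    (expR (alpha * complex.Re (inner z u)) * expR (- alpha * sqnorm u))).
  by rewrite E /test_density; ring.
rewrite mulrBr cosB sinB.
set a := expR (alpha / 2 * _); set b := expR (alpha * _); set c := expR (- alpha * _).
set k := (alpha / pi) ^+ n.
by apply/eqP; rewrite eq_complex /=; apply/andP; split; apply/eqP; ring.
Qed.

(** Cauchy-Schwarz in the plane against the unit vector of angle c. *)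
Lemma normc_ge_dir (x : R[i]) (c : R) :
  complex.Re x * cos c + complex.Im x * sin c <= normc x.
Proof.
case: x => a b /=; apply: (le_trans (ler_norm _)).
rewrite -sqrtr_sqr ler_sqrt ?addr_ge0 ?sqr_ge0//.
have := cos2Dsin2 c => H.
have := sqr_ge0 (a * sin c - b * cos c).
have : (a ^+ 2 + b ^+ 2) = (a * cos c + b * sin c) ^+ 2 + (a * sin c - b * cos c) ^+ 2.
  rewrite -[LHS]mulr1 -H; ring.
lra.
Qed.

Lemma measurable_phase s : measurable_fun setT (phase s).
Proof.
rewrite (_ : phase s = fun u : Cn => \sum_(j < n)
  (complex.Im (tnth s j) * complex.Re (tnth u j) - complex.Re (tnth s j) * complex.Im (tnth u j))).
  apply: measurable_sum => j; apply: measurable_funB; apply: measurable_funM => //.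
    exact: measurable_Re_tnth.
  exact: measurable_Im_tnth.
by apply/funext => u; rewrite phaseE.
Qed.

End phase_test.

Section phase_test_lower.
Variables (R : realType) (n : nat).
Local Notation Cn := (n.-tuple R[i]).
Local Notation v := (@lebesgue_Cn R n).
Implicit Types (z u s t : Cn) (alpha r p d : R) (h : Cn -> R).

Lemma measurable_cos_phase alpha z s : measurable_fun setT (fun u : Cn => cos (alpha * (phase z u - phase s u))).
Proof.
apply: measurableT_comp; first by apply: continuous_measurable_fun; exact: continuous_cos.
by apply: measurable_funM => //; apply: measurable_funB; exact: measurable_phase.
Qed.

Lemma measurable_sin_phase alpha z s : measurable_fun setT (fun u : Cn => sin (alpha * (phase z u - phase s u))).
Proof.
apply: measurableT_comp; first by apply: continuous_measurable_fun; exact: continuous_sin.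
by apply: measurable_funM => //; apply: measurable_funB; exact: measurable_phase.
Qed.

(** Projecting P f (z) on the direction of the phase at u = t turns the complex
integrand into its modulus times a cosine that is at least 1/2. *)
Lemma phase_test_lower alpha (kap : R) (Q : set Cn) s t h z : 0 < alpha -> 0 <= kap ->
  (forall u, 0 <= h u) -> measurable_fun setT h ->
  (\int[v]_u (h u)%:E < +oo)%E -> (forall u, ~ Q u -> h u = 0) ->
  (forall u, Q u -> 2^-1 <= cos (alpha * ((phase z u - phase s u) - (phase z t - phase s t)))) ->
  (forall u, Q u -> kap <= gauss_kernel alpha z u) ->
  ((2^-1 * (alpha / pi) ^+ n * kap)%:E * \int[v]_u (h u)%:E <=
   (fock_mod alpha (fock_proj alpha (phase_test alpha s h)) z)%:E)%E.
Proof.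
move=> al0 kap0 h0 mh hoo hQ hcos hK.
pose c : R := (alpha / pi) ^+ n * expR (alpha / 2 * sqnorm z).
have c0 : 0 <= c by rewrite mulr_ge0 ?expR_ge0// exprn_ge0// divr_ge0 ?pi_ge0// ltW.
pose G u := test_density alpha h z u.
have GE u : G u = c * (h u * gauss_kernel alpha z u) by [].
have cE : c = (alpha / pi) ^+ n * expR (alpha / 2 * sqnorm z) by [].
clearbody c.
have K1 u : gauss_kernel alpha z u <= 1.
  rewrite -expR0 ler_expR mulNr oppr_le0 mulr_ge0 ?divr_ge0 ?(ltW al0)//.
  by apply: sumr_ge0 => j _; rewrite sqr_ge0.
have K0 u : 0 <= gauss_kernel alpha z u by exact: expR_ge0.
have G0 u : 0 <= G u by rewrite GE !mulr_ge0.
have Gh u : G u <= c * h u by rewrite GE ler_wpM2l// ler_piMr.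
have mG : measurable_fun setT G.
  by apply: measurable_funM => //; apply: measurable_funM => //; exact: measurable_gauss_kernel.
have ih : v.-integrable setT (EFin \o h).
  apply/integrableP; split; first exact/measurable_EFinP.
  by rewrite (eq_integral (EFin \o h))// => u _ /=; rewrite ger0_norm.
have ich a : v.-integrable setT (EFin \o (fun u => a * h u)).
  by rewrite (_ : _ \o _ = fun u => (a%:E * (EFin \o h) u)%E)//; exact: integrableZl.
have iG (b : Cn -> R) : measurable_fun setT b -> (forall u, `|b u| <= 1) ->
    v.-integrable setT (EFin \o (fun u => G u * b u)).
  move=> mb b1; apply: (le_integrable _ _ _ (ich c)) => //.
    by apply/measurable_EFinP; exact: measurable_funM.
  move=> u _; rewrite lee_fin normrM (ger0_norm (G0 u)) (ger0_norm (mulr_ge0 c0 (h0 u))).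
  by apply: le_trans (Gh u); rewrite ler_piMr.
have icos := iG _ (measurable_cos_phase alpha z s) (fun u => cos_max _).
have isin := iG _ (measurable_sin_phase alpha z s) (fun u => sin_max _).
(* the phase of the integrand at u = t *)
pose th0 := alpha * (phase z t - phase s t).
have dir := normc_ge_dir (fock_proj alpha (phase_test alpha s h) z) th0.
pose b u := cos (alpha * ((phase z u - phase s u) - (phase z t - phase s t))).
have bE u : b u = cos (alpha * (phase z u - phase s u)) * cos th0 +
    sin (alpha * (phase z u - phase s u)) * sin th0.
  by rewrite -cosB /b /th0 mulrBr.
have mb : measurable_fun setT b.
  rewrite (funext bE); apply: measurable_funD; apply: measurable_funM => //.
    exact: measurable_cos_phase.
  exact: measurable_sin_phase.
have low : c * kap / 2 * \int[v]_u h u <= normc (fock_proj alpha (phase_test alpha s h) z).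
  apply: le_trans dir; rewrite /fock_proj /complex_integral /=.
  have -> : \int[v]_u complex.Re (fock_integrand alpha (phase_test alpha s h) z u) =
      \int[v]_u (G u * cos (alpha * (phase z u - phase s u))).
    by apply: eq_Rintegral => u _; rewrite fock_integrand_phase_test.
  have -> : \int[v]_u complex.Im (fock_integrand alpha (phase_test alpha s h) z u) =
      \int[v]_u (G u * sin (alpha * (phase z u - phase s u))).
    by apply: eq_Rintegral => u _; rewrite fock_integrand_phase_test.
  have Zr (f : Cn -> R) (x : R) : v.-integrable setT (EFin \o f) ->
      v.-integrable setT (EFin \o (fun u => f u * x)).
    move=> fi; rewrite (_ : _ \o _ = fun u => ((EFin \o f) u * x%:E)%E)//.
    exact: integrableZr.
  rewrite -RintegralZr// -RintegralZr// -RintegralD//; [|exact: Zr|exact: Zr].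
  rewrite -RintegralZl//.
  rewrite [leRHS](_ : _ = \int[v]_u (G u * b u)); last first.
    by apply: eq_Rintegral => u _; rewrite /= bE; ring.
  apply: le_Rintegral => //; first by apply: iG => // u; exact: cos_max.
  move=> u _; have [Qu|nQu] := pselect (Q u); last by rewrite GE hQ// !(mul0r, mulr0).
  rewrite GE -!mulrA; apply: ler_wpM2l => //.
  have := hcos _ Qu; rewrite -/(b u) => hb; have hk := hK _ Qu.
  rewrite [leLHS](_ : _ = h u * (kap * 2^-1)); last by ring.
  apply: ler_wpM2l => //.
  by apply: ler_pM.
rewrite /fock_mod.
have hf : (\int[v]_u (h u)%:E)%E \is a fin_num.
  by rewrite ge0_fin_numE// integral_ge0// => u _; rewrite lee_fin.
have <- : ((\int[v]_u h u)%:E = \int[v]_u (h u)%:E)%E by rewrite /Rintegral fineK.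
rewrite -EFinM lee_fin.
have e0 : 0 < expR (- (alpha / 2) * sqnorm z) by exact: expR_gt0.
apply: le_trans (ler_wpM2r (ltW e0) low).
have E : expR (alpha / 2 * sqnorm z) * expR (- (alpha / 2) * sqnorm z) = 1.
  by rewrite -expRD mulNr subrr expR0.
rewrite [leRHS](_ : _ = 2^-1 * (alpha / pi) ^+ n * kap * \int[v]_u h u *
  (expR (alpha / 2 * sqnorm z) * expR (- (alpha / 2) * sqnorm z))); last by rewrite cE; field.
by rewrite E mulr1.
Qed.

End phase_test_lower.

(** * Testing boundedness on cubes *)

Section necessity.
Variables (R : realType) (n : nat).
Local Notation Cn := (n.-tuple R[i]).
Local Notation v := (@lebesgue_Cn R n).
Implicit Types (z u s t : Cn) (alpha r p d M : R) (sigma w h : Cn -> R).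

(** Boundedness in terms of p-th powers of norms, for Borel functions. *)
Definition energy_bounded_by p alpha sigma w M : Prop := forall f : Cn -> R[i],
  measurable_fun setT f -> (fock_energy p alpha sigma f < +oo)%E ->
  (fock_energy p alpha w (fock_proj alpha f) <= M%:E * fock_energy p alpha sigma f)%E.

Lemma cos_near0 : exists2 eta : R, 0 < eta & forall x : R, `|x| <= eta -> 2^-1 <= cos x.
Proof.
have half0 : 0 < 2^-1 :> R by rewrite invr_gt0.
have /cvgrPdist_lt /(_ _ half0) /nbhs_ballP[e /= e0 He] := @continuous_cos R 0.
exists (e / 2); first by rewrite divr_gt0.
move=> x xe; have /He : ball (0 : R) e x.
  rewrite /ball /= sub0r normrN; apply: (le_lt_trans xe).
  by rewrite ltr_pdivrMr// mulr_natr mulr2n ltrDl.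
rewrite /= cos0 => /(le_lt_trans (ler_norm _)) H.
have {}H : 1 - cos x < 2^-1 by [].
lra.
Qed.

Lemma measurable_phase_test alpha s h : measurable_fun setT h ->
  measurable_fun setT (phase_test alpha s h).
Proof.
move=> mh.
have mph : measurable_fun setT (fun u => alpha * phase s u).
  by apply: measurable_funM => //; exact: measurable_phase.
have mr : measurable_fun setT (fun u => h u * expR (alpha / 2 * sqnorm u)).
  apply: measurable_funM => //; apply: measurableT_comp; first exact: measurable_expR.
  by apply: measurable_funM => //; exact: measurable_sqnorm.
rewrite (_ : phase_test alpha s h = @pair_complex R \o (fun u =>
  (h u * expR (alpha / 2 * sqnorm u) * cos (alpha * phase s u),
   - (h u * expR (alpha / 2 * sqnorm u) * sin (alpha * phase s u)))))//.
apply: measurableT_comp; first exact: measurable_pair_complex.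
apply/measurable_fun_pair.
  apply: measurable_funM => //; apply: measurableT_comp mph.
  by apply: continuous_measurable_fun; exact: continuous_cos.
apply: measurable_funN; apply: measurable_funM => //; apply: measurableT_comp mph.
by apply: continuous_measurable_fun; exact: continuous_sin.
Qed.

Local Open Scope ereal_scope.

(** The side d is chosen so that the phases oscillate little; the two cubes stay
at bounded distance, so that the Gaussian is bounded below. *)
Lemma small_cubes_test alpha r p : (0 < alpha)%R -> (0 < r)%R -> (1 <= p)%R ->
  exists2 d : R, (0 < d)%R & exists2 K : R, (0 < K)%R &
  forall sigma w M z s t h,
    borel_weight sigma -> borel_weight w -> (0 < M)%R -> energy_bounded_by p alpha sigma w M ->
    cube (r + d) z s -> cube (r + d) z t ->
    (forall u, (0 <= h u)%R) -> measurable_fun setT h ->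
    \int[v]_u (h u)%:E < +oo -> \int[v]_u (h u `^ p * sigma u)%:E < +oo ->
  wmass w (cube d s) * (\int[v]_(u in cube d t) (h u)%:E) `^ p <=
    (K * M)%:E * \int[v]_u (h u `^ p * sigma u)%:E.
Proof.
move=> al0 r0 p1; have p0 : (0 < p)%R by exact: lt_le_trans p1.
have [eta eta0 coseta] := cos_near0.
have [d d0 dsmall] : exists2 d : R, (0 < d)%R & (alpha * (n%:R * (d ^+ 2 / 2)) <= eta)%R.
  pose c := (alpha * n%:R / 2 + 1)%R.
  have c0 : (0 < c)%R by rewrite ltr_wpDl// divr_ge0// mulr_ge0// ltW.
  exists (Num.sqrt (eta / c))%R; first by rewrite sqrtr_gt0 divr_gt0.
  rewrite sqr_sqrtr ?divr_ge0 ?(ltW eta0) ?(ltW c0)//.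
  rewrite (_ : _ * _ = eta * (alpha * n%:R / 2) / c)%R; last by field; rewrite gt_eqF.
  by rewrite ler_pdivrMr// ler_pM2l// /c lerDl.
exists d => //.
(* both points lie in the cube of side r + 2d about z, hence each of them in the
   cube of twice that side about the other *)
pose kap : R := expR (- (alpha / 2) * (n%:R * ((r + d + d + (r + d + d)) ^+ 2 / 2))).
pose k1 : R := (2^-1 * (alpha / pi) ^+ n * kap)%R.
have k10 : (0 < k1)%R.
  by rewrite /k1 !mulr_gt0 ?expR_gt0 ?invr_gt0// exprn_gt0// divr_gt0// pi_gt0.
exists ((k1 `^ p)^-1)%R; first by rewrite invr_gt0 powR_gt0.
move=> sigma w M z s t h [s0 ms sfin] [w0 mw wfin] M0 HM zs zt h0 mh hoo hsoo.
have mQ := measurable_cube t (ltW d0).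
pose h1 := (h \_ (cube d t))%R.
have h10 u : (0 <= h1 u)%R by rewrite /h1 patchE; case: ifP.
have h1h u : (h1 u <= h u)%R by rewrite /h1 patchE; case: ifP.
have mh1 : measurable_fun setT h1.
  by apply/(measurable_restrictT _ mQ); exact: measurable_funS mh.
have h1oo : \int[v]_u (h1 u)%:E < +oo.
  by apply: le_lt_trans hoo; apply: ge0_le_integralW => u _; rewrite lee_fin.
pose f := phase_test alpha s h1.
have fE : fock_energy p alpha sigma f = \int[v]_u (h1 u `^ p * sigma u)%:E.
  by rewrite fock_energyE; apply: eq_integral => u _; rewrite fock_mod_phase_test.
have fle : fock_energy p alpha sigma f <= \int[v]_u (h u `^ p * sigma u)%:E.
  rewrite fE; apply: ge0_le_integralW => u _; rewrite lee_fin.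
    by rewrite mulr_ge0// powR_ge0.
  by apply: ler_wpM2r => //; apply: ge0_ler_powR; rewrite ?nnegrE ?(ltW p0).
have := HM f (measurable_phase_test alpha s mh1) (le_lt_trans fle hsoo).
rewrite {1}fock_energyE => HP.
set I := \int[v]_(u in cube d t) (h u)%:E.
have IE : I = \int[v]_u (h1 u)%:E.
  by rewrite /I integral_mkcond; apply: eq_integral => u _; rewrite /h1 !patchE; case: ifP.
have I0 : 0 <= I by apply: integral_ge0 => u _; rewrite lee_fin.
have low y : cube d s y -> k1%:E * I <= (fock_mod alpha (fock_proj alpha f) y)%:E.
  move=> sy; rewrite IE; apply: (phase_test_lower (Q := cube d t) (t := t)) => //.
  - exact: expR_ge0.
  - by move=> u tu; rewrite /h1 patchE memNset.
  - move=> u tu; apply: coseta; rewrite normrM gtr0_norm//.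
    apply: le_trans dsmall; rewrite ler_pM2l//; exact: phase_oscillation.
  - move=> u tu; apply: gauss_kernel_ge (ltW al0) _.
    by apply: cube_trans (cube_trans zt tu); apply/cubeC; exact: cube_trans zs sy.
have If : I \is a fin_num by rewrite ge0_fin_numE// IE.
rewrite -(fineK If) in low *; move: (fine_ge0 I0) low; move: (fine I) => J J0 low.
have HQ : (((k1 * J) `^ p)%:E * wmass w (cube d s)) <= M%:E * \int[v]_u (h u `^ p * sigma u)%:E.
  apply: (@le_trans _ _ (\int[v]_y (fock_mod alpha (fock_proj alpha f) y `^ p * w y)%:E)); last first.
    by apply: (le_trans HP); apply: lee_wpmul2l => //; rewrite lee_fin ltW.
  have -> : ((k1 * J) `^ p)%:E * wmass w (cube d s) =
      \int[v]_(y in cube d s) (((k1 * J) `^ p)%:E * (w y)%:E).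
    rewrite ge0_integralZl//; first last.
    - by rewrite lee_fin powR_ge0.
    - by move=> y _; rewrite lee_fin.
    - by apply/measurable_EFinP; exact: measurable_funS mw.
    - exact: measurable_cube (ltW d0).
  apply: (@le_trans _ _ (\int[v]_(y in cube d s) (fock_mod alpha (fock_proj alpha f) y `^ p * w y)%:E)).
    apply: ge0_le_integralW => y sy; first by rewrite -EFinM lee_fin mulr_ge0// powR_ge0.
    rewrite -EFinM lee_fin; apply: ler_wpM2r => //.
    have := low _ sy; rewrite -EFinM lee_fin => H.
    have kJ0 : (0 <= k1 * J)%R by rewrite mulr_ge0// ltW.
    by apply: ge0_ler_powR; rewrite ?nnegrE ?(ltW p0) ?(le_trans kJ0 H).
  by apply: ge0_subset_integralW => // y _; rewrite lee_fin mulr_ge0// powR_ge0.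
have kp0 : (0 < k1 `^ p)%R by rewrite powR_gt0.
rewrite EFinM -muleA lee_pdivlMl//; apply: le_trans HQ.
by rewrite powRM ?(ltW k10)// EFinM muleAC -muleA poweR_EFin.
Qed.

End necessity.

Section test_inequality.
Variables (R : realType) (n : nat).
Local Notation Cn := (n.-tuple R[i]).
Local Notation v := (@lebesgue_Cn R n).
Implicit Types (z u s t : Cn) (alpha r p d M : R) (sigma w h : Cn -> R).
Local Open Scope ereal_scope.

(** Apply the covering bound to h for a fixed small cube Q_d(s), then to w. *)
Lemma cube_test alpha r p : (0 < alpha)%R -> (0 < r)%R -> (1 <= p)%R ->
  exists2 K : R, (0 < K)%R &
  forall sigma w M z h,
    borel_weight sigma -> borel_weight w -> (0 < M)%R -> energy_bounded_by p alpha sigma w M ->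
    (forall u, (0 <= h u)%R) -> measurable_fun setT h ->
    \int[v]_(u in cube r z) (h u)%:E < +oo ->
    \int[v]_(u in cube r z) (h u `^ p * sigma u)%:E < +oo ->
  wmass w (cube r z) * (\int[v]_(u in cube r z) (h u)%:E) `^ p <=
    (K * M)%:E * \int[v]_(u in cube r z) (h u `^ p * sigma u)%:E.
Proof.
move=> al0 r0 p1; have p0 : (0 < p)%R by exact: lt_le_trans p1.
have [d d0 [K0 K00 HK]] := small_cubes_test n al0 r0 p1.
pose N : R := (((r + d) / d) ^+ (2 * n))%R.
have N0 : (0 < N)%R by rewrite exprn_gt0// divr_gt0// addr_gt0.
exists (N * N `^ p * K0)%R; first by rewrite !mulr_gt0// powR_gt0.
move=> sigma w M z h hs hw M0 HM h0 mh hoo hsoo.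
have {HK HM}HK := HK _ _ _ _ _ _ _ hs hw M0 HM.
have [w0 mw wfin] := hw; have [s0 ms sfin] := hs.
set Q := cube r z in hoo hsoo *.
have mQ : measurable Q := measurable_cube z (ltW r0).
pose h1 := (h \_ Q)%R.
have h10 u : (0 <= h1 u)%R by rewrite /h1 patchE; case: ifP.
have mh1 : measurable_fun setT h1.
  by apply/(measurable_restrictT _ mQ); exact: measurable_funS mh.
have h1p u : h1 u = if u \in Q then h u else 0%R by rewrite /h1 patchE.
clearbody h1.
have B0 : 0 <= \int[v]_(u in Q) (h u `^ p * sigma u)%:E.
  by apply: integral_ge0 => u _; rewrite lee_fin mulr_ge0// powR_ge0.
have I0 : 0 <= \int[v]_(u in Q) (h u)%:E by apply: integral_ge0 => u _; rewrite lee_fin.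
have Bf : \int[v]_(u in Q) (h u `^ p * sigma u)%:E \is a fin_num by rewrite ge0_fin_numE.
have If : \int[v]_(u in Q) (h u)%:E \is a fin_num by rewrite ge0_fin_numE.
have small s t : cube (r + d) z s -> cube (r + d) z t ->
    wmass w (cube d s) * (\int[v]_(u in cube d t) (h1 u)%:E) `^ p <=
    (K0 * M * fine (\int[v]_(u in Q) (h u `^ p * sigma u)%:E))%:E.
  move=> zs zt; have := HK _ _ _ _ zs zt h10 mh1.
  have -> : \int[v]_u (h1 u)%:E = \int[v]_(u in Q) (h u)%:E.
    by rewrite [RHS]integral_mkcond; apply: eq_integral => u _; rewrite h1p !patchE; case: ifP.
  have -> : \int[v]_u (h1 u `^ p * sigma u)%:E = \int[v]_(u in Q) (h u `^ p * sigma u)%:E.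
    rewrite [RHS]integral_mkcond; apply: eq_integral => u _; rewrite h1p !patchE.
    by case: ifP => // _; rewrite powR0 ?gt_eqF// mul0r.
  by move=> /(_ hoo hsoo) /le_trans; apply; rewrite [X in _ <= X]EFinM fineK.
have Hle x : \int[v]_(u in Q) (h u)%:E <= x%:E -> (fine (\int[v]_(u in Q) (h u)%:E) <= x)%R.
  by rewrite -lee_fin fineK.
have B0' := fine_ge0 B0; have H0 := fine_ge0 I0.
rewrite -(fineK If) -(fineK Bf) poweR_EFin.
clear B0 I0 If Bf HK hoo hsoo.
move: B0' H0 Hle small; move: (fine _) => B; move: (fine _) => H B0' H0 Hle small.
have KMB0 : (0 <= K0 * M * B)%R by rewrite !mulr_ge0// ltW.
(* where w has no mass the inequality is trivial; elsewhere it bounds the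
   integrals of h over all small cubes by the same b *)
have covt s : cube (r + d) z s ->
    wmass w (cube d s) * (H `^ p)%:E <= (N `^ p * (K0 * M * B))%:E.
  move=> zs; have wf : wmass w (cube d s) \is a fin_num by rewrite ge0_fin_numE ?wfin// wmass_ge0.
  have W0 : (0 <= fine (wmass w (cube d s)))%R by rewrite fine_ge0// wmass_ge0.
  have small' := small s ^~ zs.
  move: small'; rewrite -(fineK wf); move: W0; move: (fine (wmass w _)) => W.
  rewrite le_eqVlt => /predU1P[<- _|W0 small'].
    by rewrite mul0e lee_fin mulr_ge0// powR_ge0.
  pose b := ((K0 * M * B / W) `^ p^-1)%R.
  have bp : (b `^ p = K0 * M * B / W)%R.
    by rewrite /b -powRrM mulVf ?gt_eqF// powRr1// divr_ge0// ltW.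
  have HN : (H <= N * b)%R.
    apply: Hle; apply: (cube_covering_bound (h := EFin \o h)) => //.
    - exact: ltW.
    - exact: powR_ge0.
    - exact/measurable_EFinP.
    move=> t zt.
    have -> : \int[v]_(u in cube d t) ((EFin \o h) \_ (cube r z)) u = \int[v]_(u in cube d t) (h1 u)%:E.
      by apply: eq_integral => u _; rewrite h1p !patchE; case: ifP.
    apply: poweR_le_root => //.
      by apply: integral_ge0 => u _; rewrite lee_fin.
      by rewrite divr_ge0// ltW.
    by rewrite EFinM lee_pdivlMr// muleC; exact: small'.
  rewrite -EFinM lee_fin.
  apply: (@le_trans _ _ (W * (N * b) `^ p)%R).
    apply: ler_wpM2l; first exact: ltW.
    by apply: ge0_ler_powR; rewrite ?nnegrE ?(ltW p0) ?mulr_ge0 ?powR_ge0 ?(ltW N0).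
  rewrite powRM ?powR_ge0 ?(ltW N0)// bp le_eqVlt; apply/orP; left; apply/eqP.
  by field; rewrite gt_eqF.
have [H_0|Hn0] := eqVneq H 0%R.
  rewrite H_0 powR0 ?gt_eqF// mule0 -EFinM lee_fin !mulr_ge0 ?powR_ge0//; exact: ltW.
have Hp0 : (0 < H `^ p)%R by rewrite powR_gt0// lt_neqAle eq_sym Hn0.
pose b' := (N `^ p * (K0 * M * B) / H `^ p)%R.
have b'0 : (0 <= b')%R by rewrite divr_ge0 ?powR_ge0// mulr_ge0 ?powR_ge0.
have : wmass w (cube r z) <= (N * b')%:E.
  apply: (cube_covering_bound (h := EFin \o w)) => //.
  - exact: ltW.
  - exact/measurable_EFinP.
  move=> s zs; apply: (@le_trans _ _ (wmass w (cube d s))).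
    apply: ge0_le_integralW => u _; rewrite patchE; case: ifP => // _; by rewrite lee_fin.
  by rewrite /b' EFinM lee_pdivlMr//; exact: covt.
have Hp00 : 0 <= (H `^ p)%:E by rewrite lee_fin powR_ge0.
move=> /(lee_wpmul2r Hp00) /le_trans; apply.
rewrite -!EFinM lee_fin le_eqVlt; apply/orP; left; apply/eqP; rewrite /b'.
by field; rewrite gt_eqF.
Qed.

End test_inequality.

(** * Boundedness implies the A_p condition *)

Section A_const_necessity.
Variables (R : realType) (n : nat).
Local Notation Cn := (n.-tuple R[i]).
Local Notation v := (@lebesgue_Cn R n).
Implicit Types (z u s t : Cn) (alpha r p d M : R) (sigma w h : Cn -> R).
Local Open Scope ereal_scope.

(** Bounded approximations of sigma^(-q) from below, finite where sigma
vanishes. *)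
Definition truncated_power (q : R) sigma (m : nat) u : R :=
  (Num.max (sigma u) (m.+1%:R^-1) `^ (- q))%R.

Section truncation.
Variables (q : R) (sigma : Cn -> R).
Hypotheses (q0 : (0 < q)%R) (s0 : forall u, (0 <= sigma u)%R) (ms : measurable_fun setT sigma).
Local Notation h := (truncated_power q sigma).

Let max_gt0 m u : (0 < Num.max (sigma u) m.+1%:R^-1)%R.
Proof. by rewrite lt_max invr_gt0 ltr0Sn orbT. Qed.

Lemma truncated_power_ge0 m u : (0 <= h m u)%R.
Proof. exact: powR_ge0. Qed.

Lemma measurable_truncated_power m : measurable_fun setT (h m).
Proof.
exact: (measurableT_comp (measurable_powR (- q)) (measurable_maxr ms (measurable_cst _))).
Qed.

Lemma powRN_antitone (x y : R) : (0 < x)%R -> (x <= y)%R -> (y `^ (- q) <= x `^ (- q))%R.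
Proof.
move=> x0 xy; have y0 : (0 < y)%R by exact: lt_le_trans xy.
rewrite !powRN lef_pV2 ?posrE ?powR_gt0//.
by apply: ge0_ler_powR; rewrite ?nnegrE ?(ltW x0) ?(ltW y0) ?(ltW q0).
Qed.

Lemma truncated_power_nd u : {homo (fun m => (h m u)%:E) : m k / (m <= k)%N >-> m <= k}.
Proof.
move=> m k mk; rewrite lee_fin; apply: powRN_antitone => //.
by rewrite ge_max le_max lexx/= le_max lef_pV2 ?posrE// ler_nat ltnS mk orbT.
Qed.

Lemma truncated_power_le m u : (h m u <= (m.+1%:R^-1) `^ (- q))%R.
Proof. by apply: powRN_antitone; rewrite ?invr_gt0// le_max lexx orbT. Qed.

(** For q = 1 / (p - 1), h^(p-1) is the inverse of max(sigma, 1 / (m + 1)). *)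
Lemma truncated_power_energy p m u : (0 < p)%R -> (q * (p - 1) = 1)%R ->
  (h m u `^ p * sigma u <= h m u)%R.
Proof.
move=> p0 qp; rewrite -(mulr_powRB1 (truncated_power_ge0 m u) p0) -mulrA.
rewrite ler_piMr ?truncated_power_ge0//.
rewrite /truncated_power -powRrM mulNr qp powR_inv1 ?(ltW (max_gt0 _ _))//.
by rewrite mulrC ler_pdivrMr// mul1r le_max lexx.
Qed.

(** The supremum is attained where sigma is positive and infinite where it
vanishes. *)
Lemma inv_power_le_sup u : ((sigma u)%:E)^-1 `^ q <= ereal_sup (range (fun m => (h m u)%:E)).
Proof.
rewrite inv_poweRE//; case: eqP => [su|/eqP su].
  rewrite leye_eq; apply/eqP/eq_infty => x.
  pose m := Num.truncn (Num.max 0 x `^ q^-1)%R.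
  apply: (@le_trans _ _ (h m u)%:E); last by apply: ereal_sup_ubound; exists m.
  have mx : (Num.max (sigma u) m.+1%:R^-1 = m.+1%:R^-1)%R.
    by rewrite su; apply: max_r; rewrite invr_ge0.
  rewrite lee_fin /truncated_power mx -[(m.+1%:R^-1)%R]powR_inv1// -powRrM mulN1r opprK.
  apply: (@le_trans _ _ (Num.max 0 x)%R); first by rewrite le_max lexx orbT.
  have x0 : (0 <= Num.max 0 x)%R by rewrite le_max lexx.
  have -> : (Num.max 0 x = (Num.max 0 x `^ q^-1) `^ q)%R.
    by rewrite -powRrM mulVf ?gt_eqF// powRr1.
  apply: ge0_ler_powR; rewrite ?nnegrE ?powR_ge0 ?(ltW q0)//.
  by rewrite ltW//; exact: truncnS_gt.
have s_gt0 : (0 < sigma u)%R by rewrite lt_neqAle eq_sym su s0.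
pose m := Num.truncn (sigma u)^-1%R.
apply: ereal_sup_ubound; exists m => //; congr (_ `^ _)%:E.
apply: max_l; rewrite invf_ple ?posrE//; exact/ltW/truncnS_gt.
Qed.

End truncation.

(** Test on h with h^p sigma <= h: the test inequality loses one power of the
integral of h and becomes a bound for it, uniform in the truncation.  For p = 1,
if sigma were less than half the expected bound on a set of positive measure,
the indicator of this set would violate the test inequality. *)
Lemma A_const_le_of_bounded alpha r p : (0 < alpha)%R -> (0 < r)%R -> (1 <= p)%R ->
  exists2 K : R, (0 < K)%R & forall sigma w M,
    borel_weight sigma -> borel_weight w -> (0 < M)%R -> energy_bounded_by p alpha sigma w M ->
    A_const p r w sigma <= (K * M)%:E.
Proof.
move=> al0 r0 p1; have p0 : (0 < p)%R by exact: lt_le_trans p1.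
have [K K0 HK] := cube_test n al0 r0 p1.
pose V : R := (r ^+ (2 * n))%R; have V0 : (0 < V)%R by exact: exprn_gt0.
have Vp0 : (0 < V `^ p)%R by exact: powR_gt0.
exists (2 * K / V `^ p)%R; first by rewrite divr_gt0// mulr_gt0.
move=> sigma w M hs hw M0 HM.
have {HK HM}HK z h := HK _ _ _ z h hs hw M0 HM.
have [w0 mw wfin] := hw; have [s0 ms sfin] := hs.
have a0 : (0 <= 2 * K / V `^ p * M)%R by rewrite mulr_ge0 ?divr_ge0 ?mulr_ge0// ltW.
rewrite /A_const; case: eqVneq => [pE|pn1]; apply: ge_ereal_sup => _ [t _ <-].
  have [W0|Wn0] := eqVneq (wmass w (cube r t)) 0.
    by rewrite average_cube// [X in _ * X * _]W0 mule0 mul0e lee_fin.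
  have W0 : 0 < wmass w (cube r t) by rewrite lt0e Wn0 wmass_ge0.
  apply/A1_term_leP => //; first exact: wfin.
  have Wf : wmass w (cube r t) \is a fin_num by rewrite ge0_fin_numE ?wfin// wmass_ge0.
  have W0' : (0 < fine (wmass w (cube r t)))%R by rewrite fine_gt0// W0 wfin.
  have aV : (2 * K / V `^ p * M * r ^+ (2 * n) = 2 * K * M)%R.
    have -> : (V `^ p = r ^+ (2 * n))%R by rewrite pE powRr1// ltW.
    by field; rewrite gt_eqF.
  rewrite aV; have := HK t; rewrite -(fineK Wf) /=.
  move: W0'; move: (fine _) => W W0' {}HK.
  (* half of the bound that the test inequality gives on positive measure *)
  pose l : R := (W / (2 * K * M))%R.
  have KM0 : (0 < 2 * K * M)%R by rewrite !mulr_gt0.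
  have l0 : (0 < l)%R by rewrite divr_gt0.
  pose E := cube r t `&` [set u | (sigma u < l)%R].
  have mE : measurable E.
    apply: measurableI; first exact: measurable_cube (ltW r0).
    rewrite (_ : [set u | _] = sigma @^-1` `]-oo, l[).
      by rewrite -[X in measurable X]setTI; apply: ms.
    by apply/seteqP; split => u /=; rewrite in_itv.
  exists E; split => //; last first.
    move=> u /= /not_implyP[tu /negP]; rewrite -ltNge => su; split => //=.
    by rewrite /l ltr_pdivlMr// mulrC.
  have mind : measurable_fun setT (\1_E : Cn -> R) by exact/measurable_indicP.
  have iE : \int[v]_(u in cube r t) (\1_E u)%:E = v E.
    rewrite integral_indic//; last exact: measurable_cube (ltW r0).
    by congr (v _); rewrite setIC /E setIA setIid.
  have vE : v E < +oo.
    apply: (@le_lt_trans _ _ (v (cube r t))); last by rewrite volume_cube ?ltry// ltW.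
    by apply: le_measure; rewrite ?inE//; [exact: measurable_cube (ltW r0)|exact: subIsetl].
  have vEf : v E \is a fin_num by rewrite ge0_fin_numE// measure_ge0.
  have sE : \int[v]_(u in cube r t) (\1_E u `^ p * sigma u)%:E <= l%:E * v E.
    rewrite -iE -ge0_integralZl//; first last.
    - by rewrite lee_fin ltW.
    - by apply/measurable_EFinP; exact: measurable_funS mind.
    - exact: measurable_cube (ltW r0).
    apply: ge0_le_integralW => u _; first by rewrite lee_fin mulr_ge0// powR_ge0.
    rewrite -EFinM lee_fin indicE; have [/set_mem [tu /= su]|nE] := boolP (u \in E).
      by rewrite powR1 mul1r mulr1 ltW.
    by rewrite powR0 ?gt_eqF// mul0r mulr0.
  have := HK \1_E (fun u => _) mind.
  rewrite iE => /(_ (fun u => ler0n _ _) vE).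
  have sEoo : \int[v]_(u in cube r t) (\1_E u `^ p * sigma u)%:E < +oo.
    by apply: (le_lt_trans sE); rewrite -(fineK vEf) -EFinM ltry.
  move=> /(_ sEoo) /le_trans.
  move=> /(_ ((K * M)%:E * (l%:E * v E))).
  have -> : v E `^ p = v E by rewrite pE poweRe1// measure_ge0.
  have KM00 : 0 <= (K * M)%:E by rewrite lee_fin mulr_ge0// ltW.
  move=> /(_ (lee_wpmul2l KM00 sE)).
  have := fine_ge0 (measure_ge0 v E); rewrite -(fineK vEf) /=.
  move: (fine _) => x x0; rewrite -!EFinM lee_fin.
  rewrite (_ : K * M * (l * x) = W * x / 2)%R; last by rewrite /l; field; rewrite !gt_eqF.
  move=> H; congr (_%:E); apply/eqP; rewrite eq_le x0 andbT.
  have Wx : (W * x <= 0)%R by move: H; clear; lra.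
  by rewrite -(pmulr_rle0 _ W0').
have {pn1}p1' : (1 < p)%R by rewrite lt_neqAle eq_sym pn1.
have q0 : (0 < (p - 1)^-1)%R by rewrite invr_gt0 subr_gt0.
have qp : ((p - 1)^-1 * (p - 1) = 1)%R by rewrite mulVf// gt_eqF// subr_gt0.
have [W0|Wn0] := eqVneq (wmass w (cube r t)) 0.
  by rewrite average_cube// [X in _ * X * _]W0 mule0 mul0e lee_fin.
have W0 : 0 < wmass w (cube r t) by rewrite lt0e Wn0 wmass_ge0.
apply/Ap_term_leP => //; first exact: wfin.
have Wf : wmass w (cube r t) \is a fin_num by rewrite ge0_fin_numE ?wfin// wmass_ge0.
have W0' : (0 < fine (wmass w (cube r t)))%R by rewrite fine_gt0// W0 wfin.
have := HK t; rewrite -(fineK Wf) /=.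
move: W0'; move: (fine _) => W W0' {}HK.
pose q := (p - 1)^-1%R; rewrite -/q in q0 qp *.
pose h := truncated_power q sigma.
pose b := ((K * M / W) `^ q)%R.
have KMW0 : (0 < K * M / W)%R by rewrite divr_gt0// mulr_gt0.
have mQ := measurable_cube t (ltW r0).
have hb m : \int[v]_(u in cube r t) (h m u)%:E <= b%:E.
  have mh := measurable_truncated_power q ms m.
  have h0 u := truncated_power_ge0 q sigma m u.
  have I0 : 0 <= \int[v]_(u in cube r t) (h m u)%:E.
    by apply: integral_ge0 => u _; rewrite lee_fin.
  have Ioo : \int[v]_(u in cube r t) (h m u)%:E < +oo.
    apply: (@le_lt_trans _ _ (\int[v]_(u in cube r t) ((m.+1%:R^-1) `^ (- q))%:E)).
      by apply: ge0_le_integralW => u _; rewrite lee_fin//; exact: truncated_power_le.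
    by rewrite integral_cst// [X in _ * X]volume_cube ?ltW// -EFinM ltry.
  have eI : \int[v]_(u in cube r t) (h m u `^ p * sigma u)%:E <=
      \int[v]_(u in cube r t) (h m u)%:E.
    apply: ge0_le_integralW => u _; rewrite lee_fin; first by rewrite mulr_ge0// powR_ge0.
    exact: truncated_power_energy.
  have := HK (h m) h0 mh Ioo (le_lt_trans eI Ioo).
  have KM00 : 0 <= (K * M)%:E by rewrite lee_fin mulr_ge0// ltW.
  move=> /le_trans /(_ (lee_wpmul2l KM00 eI)).
  have If : \int[v]_(u in cube r t) (h m u)%:E \is a fin_num by rewrite ge0_fin_numE.
  have := fine_ge0 I0; rewrite -(fineK If) /=; move: (fine _) => x x0.
  rewrite -?EFinM !lee_fin -(mulr_powRB1 x0 p0).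
  move: x0; rewrite le_eqVlt => /predU1P[<- _|x0]; first exact: powR_ge0.
  rewrite mulrCA [leRHS]mulrC ler_pM2l// mulrC -ler_pdivlMr// => H.
  have q1 : (0 < p - 1)%R by rewrite subr_gt0.
  have -> : (x = (x `^ (p - 1)) `^ q)%R.
    by rewrite -powRrM mulrC qp powRr1// ltW.
  by apply: ge0_ler_powR; rewrite ?nnegrE ?powR_ge0 ?(ltW q0) ?(ltW KMW0).
have nd u : {homo (fun m => (h m u)%:E) : m k / (m <= k)%N >-> m <= k}.
  exact: truncated_power_nd.
have mhE m : measurable_fun (cube r t) (fun u => (h m u)%:E).
  apply/measurable_EFinP; apply: measurable_funS (measurable_truncated_power q ms m) => //.
have h0E m u : cube r t u -> 0 <= (h m u)%:E.
  by rewrite lee_fin truncated_power_ge0.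
apply: (@le_trans _ _ (\int[v]_(u in cube r t) limn (fun m => (h m u)%:E))).
  apply: ge0_le_integralW => u _; first exact: poweR_ge0.
  have /cvg_lim -> // := ereal_nondecreasing_cvgn (@nd u).
  exact: inv_power_le_sup.
rewrite monotone_convergence//.
apply: (@le_trans _ _ b%:E).
  apply: lime_le; last by apply: nearW => m; exact: hb.
  apply: ereal_nondecreasing_is_cvgn => m k mk.
  apply: ge0_le_integralW => u tu; [exact: h0E|exact: nd].
rewrite lee_fin /b.
have -> : (r ^+ (2 * n) * (2 * K / V `^ p * M * r ^+ (2 * n) / W) `^ q = (2 * (K * M / W)) `^ q)%R.
  have {1}-> : (r ^+ (2 * n) = (V `^ (p - 1)) `^ q)%R.
    by rewrite -powRrM mulrC qp powRr1// ltW.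
  rewrite -/V -powRM ?powR_ge0//; last first.
    by rewrite !mulr_ge0 ?invr_ge0 ?powR_ge0 ?(ltW V0) ?(ltW K0) ?(ltW M0) ?(ltW W0').
  congr (_ `^ q)%R; rewrite -(mulr_powRB1 (ltW V0) p0); field.
  by rewrite !gt_eqF// powR_gt0.
apply: ge0_ler_powR; rewrite ?nnegrE ?(ltW q0) ?(ltW KMW0)//.
  by rewrite mulr_ge0// ltW.
by rewrite ler_peMl ?(ltW KMW0)// ler1n.
Qed.

End A_const_necessity.

(** * Passing to Borel representatives *)

Section null_modifications.
Variables (R : realType) (n : nat).
Local Notation Cn := (n.-tuple R[i]).
Local Notation v := (@lebesgue_Cn R n).
Implicit Types (z u s t : Cn) (alpha r p C a : R) (sigma w h : Cn -> R) (f : Cn -> R[i]).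
Local Open Scope ereal_scope.

Lemma ae_eq_Rintegral (F G : Cn -> R) : {ae v, forall u, F u = G u} ->
  (\int[v]_u F u = \int[v]_u G u)%R.
Proof.
move=> FG; rewrite /Rintegral; congr fine; rewrite integralE [RHS]integralE.
congr (_ - _); apply: ae_ge0_eq_integral => //;
  by apply: filterS FG => u Fu _; rewrite ?funeposE ?funenegE /= Fu.
Qed.

Lemma ae_eq_complex_integral (F G : Cn -> R[i]) : {ae v, forall u, F u = G u} ->
  complex_integral F = complex_integral G.
Proof.
by move=> FG; congr (_ +i* _); apply: ae_eq_Rintegral; apply: filterS FG => u ->.
Qed.

Section same_function.
Variables (f g : Cn -> R[i]).
Hypothesis fg : {ae v, forall u, f u = g u}.

Let fgi alpha z : {ae v, forall u, fock_integrand alpha f z u = fock_integrand alpha g z u}.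
Proof. by apply: filterS fg => u fu; rewrite /fock_integrand fu. Qed.

Lemma ae_eq_fock_proj alpha : fock_proj alpha f = fock_proj alpha g.
Proof. by apply/funext => z; exact: ae_eq_complex_integral. Qed.

Lemma ae_eq_fock_proj_cvg alpha : fock_proj_cvg alpha f = fock_proj_cvg alpha g.
Proof.
apply/funext => z; rewrite /fock_proj_cvg; congr (_ < _).
apply: ae_ge0_eq_integral => [u _|u _|]; try by rewrite lee_fin normc_ge0.
by apply: filterS (fgi alpha z) => u -> _.
Qed.

Lemma ae_eq_fock_energy_l p alpha w : (forall u, (0 <= w u)%R) ->
  fock_energy p alpha w f = fock_energy p alpha w g.
Proof.
move=> w0; apply: ae_ge0_eq_integral => [u _|u _|].
- by rewrite lee_fin !mulr_ge0 ?powR_ge0 ?expR_ge0.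
- by rewrite lee_fin !mulr_ge0 ?powR_ge0 ?expR_ge0.
by apply: filterS fg => u -> _.
Qed.

End same_function.

Section same_weight.
Variables (w w' : Cn -> R).
Hypotheses (w0 : forall u, (0 <= w u)%R) (w'0 : forall u, (0 <= w' u)%R).
Hypothesis ww' : {ae v, forall u, w u = w' u}.

Lemma ae_eq_wmass (E : set Cn) : wmass w E = wmass w' E.
Proof.
apply: ae_ge0_eq_integral => [u _|u _|]; rewrite ?lee_fin//.
by apply: filterS ww' => u -> _.
Qed.

Lemma ae_eq_fock_energy_r p alpha f : fock_energy p alpha w f = fock_energy p alpha w' f.
Proof.
apply: ae_ge0_eq_integral => [u _|u _|].
- by rewrite lee_fin !mulr_ge0 ?powR_ge0 ?expR_ge0.
- by rewrite lee_fin !mulr_ge0 ?powR_ge0 ?expR_ge0.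
by apply: filterS ww' => u -> _.
Qed.

Lemma ae_eq_doubling r D : doubling r D w -> doubling r D w'.
Proof. by case=> D1 H; split=> // z; rewrite -!ae_eq_wmass. Qed.

Lemma ae_eq_weight_ae (P : Cn -> Prop) : weight_ae w P <-> weight_ae w' P.
Proof. by split=> -[N [mN wN PN]]; exists N; split=> //; rewrite -wN ae_eq_wmass. Qed.

Lemma ae_eq_A_const_l p r sigma : A_const p r w sigma = A_const p r w' sigma.
Proof.
have av z : average (cube r z) (EFin \o w) = average (cube r z) (EFin \o w').
  by congr (_ * _); exact: ae_eq_wmass.
rewrite /A_const; case: (p == 1)%R; apply: (congr1 (@ereal_sup R)).
  by apply: eq_imagel => z _; rewrite av.
by apply: eq_imagel => z _; rewrite av.
Qed.

Lemma ae_eq_A_const_r p r (u0 : Cn -> R) : A_const p r u0 w = A_const p r u0 w'.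
Proof.
have H z (q : R) : \int[v]_(u in cube r z) (((w u)%:E)^-1 `^ q) =
    \int[v]_(u in cube r z) (((w' u)%:E)^-1 `^ q).
  apply: ae_ge0_eq_integral => [u _|u _|]; try exact: poweR_ge0.
  by apply: filterS ww' => u -> _.
have L z : Lnorm v +oo ((fun u => ((w u)%:E)^-1) \_ (cube r z)) =
    Lnorm v +oo ((fun u => ((w' u)%:E)^-1) \_ (cube r z)).
  rewrite unlock volume_Cn_gt0; apply: eq_ess_sup.
  by apply: filterS ww' => u /= wu; rewrite !patchE wu.
have av z (q : R) : average (cube r z) (fun u => ((w u)%:E)^-1 `^ q) =
    average (cube r z) (fun u => ((w' u)%:E)^-1 `^ q).
  by congr (_ * _); exact: H.
rewrite /A_const; case: (p == 1)%R; apply: (congr1 (@ereal_sup R)).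
  by apply: eq_imagel => z _; rewrite L.
by apply: eq_imagel => z _; rewrite av.
Qed.

End same_weight.

Lemma weight_borel w : weight w -> exists2 w', borel_weight w' & {ae v, forall u, w u = w' u}.
Proof.
move=> [w0 [g mg wg] wfin].
pose w' u := Num.max (g u) 0%R.
have w'0 u : (0 <= w' u)%R by rewrite /w' le_max lexx orbT.
have ww' : {ae v, forall u, w u = w' u}.
  by apply: filterS wg => u wgu; rewrite /w' -wgu; apply/esym/max_l.
exists w' => //; split => //.
  exact: (measurable_maxr mg (measurable_cst _)).
by move=> z r r0; rewrite -(ae_eq_wmass w0 w'0 ww')// wfin.
Qed.

End null_modifications.

(** * The two norm estimates *)

Section two_bounds.
Variables (R : realType) (n : nat).
Local Notation Cn := (n.-tuple R[i]).
Local Notation v := (@lebesgue_Cn R n).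
Implicit Types (z u s t : Cn) (alpha r p C a : R) (sigma w h : Cn -> R) (f : Cn -> R[i]).
Local Open Scope ereal_scope.

(** The supremum is over a nonempty family, so it is not -oo. *)
Lemma A_const_ge0 p r w sigma : (0 < r)%R -> (forall u, (0 <= w u)%R) -> 0 <= A_const p r w sigma.
Proof.
move=> r0 w0; pose z0 : Cn := [tuple 0%R | j < n].
have av0 z (F : Cn -> \bar R) : (forall u, 0 <= F u) -> 0 <= average (cube r z) F.
  move=> F0; rewrite average_cube// mule_ge0 ?integral_ge0//.
  by rewrite lee_fin invr_ge0 exprn_ge0// ltW.
have w0E u : 0 <= (EFin \o w) u by rewrite lee_fin.
rewrite /A_const; case: ifP => _.
  apply: le_trans (ereal_sup_ubound _); last by exists z0.
  by rewrite mule_ge0 ?av0// Lnorm_ge0.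
apply: le_trans (ereal_sup_ubound _); last by exists z0.
by rewrite mule_ge0 ?av0// poweR_ge0.
Qed.

Lemma fock_energy_ge0 p alpha w f : (forall u, (0 <= w u)%R) -> 0 <= fock_energy p alpha w f.
Proof.
by move=> w0; apply: integral_ge0 => u _; rewrite lee_fin !mulr_ge0 ?powR_ge0 ?expR_ge0.
Qed.

Lemma fock_proj_bounded_by_le p alpha sigma w C C' : (C <= C')%R ->
  fock_proj_bounded_by p alpha sigma w C -> fock_proj_bounded_by p alpha sigma w C'.
Proof.
move=> CC' H f /H[cv le]; split=> //; apply: le_trans le _.
by apply: lee_wpmul2r; rewrite ?poweR_ge0// lee_fin.
Qed.

Lemma energy_bounded_by_of_fock_proj p alpha sigma w C : (0 < p)%R -> (0 <= C)%R ->
  (forall u, (0 <= w u)%R) -> (forall u, (0 <= sigma u)%R) ->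
  fock_proj_bounded_by p alpha sigma w C -> energy_bounded_by p alpha sigma w (C `^ p).
Proof.
move=> p0 C0 w0 s0 H f mf foo.
have [|_] := H f; first by split => //; exists f => //; exact: aeW.
rewrite /fock_norm => /(gt0_ler_poweR (ltW p0)).
rewrite !in_itv /= !leey poweR_ge0 mule_ge0 ?poweR_ge0 ?lee_fin//= => /(_ isT isT).
rewrite poweRM ?poweR_ge0 ?lee_fin// -!poweRrM mulVf ?gt_eqF// !poweRe1 ?fock_energy_ge0//.
Qed.

(** The energy estimate holds for every real a > A, which must be positive; letting
a decrease to A covers A = 0. *)
Lemma fock_proj_bounded_of_A_const alpha r p D : (0 < alpha)%R -> (0 < r)%R -> (1 <= p)%R -> (1 <= D)%R ->
  exists2 K : R, (0 < K)%R & forall sigma w (A : R),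
    weight sigma -> weight w -> doubling r D w -> A_const p r w sigma = A%:E ->
    fock_proj_bounded_by p alpha sigma w (K * A `^ p^-1).
Proof.
move=> al0 r0 p1 D1; have p0 : (0 < p)%R by exact: lt_le_trans p1.
have [K K0 HK] := fock_energy_proj_le n al0 r0 p1 D1.
exists (K `^ p^-1)%R; first exact: powR_gt0.
move=> sigma w A hs hw dw AE f [[f' mf' ff'] foo].
have [s0 _ _] := hs; have [w0 _ _] := hw.
have A0 : (0 <= A)%R by rewrite -lee_fin -AE A_const_ge0.
have [sigma' hs' ss'] := weight_borel hs; have [w' hw' ww'] := weight_borel hw.
have [s'0 _ _] := hs'; have [w'0 _ _] := hw'.
have dw' := ae_eq_doubling w0 w'0 ww' dw.
have AE' : A_const p r w' sigma' = A%:E.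
  by rewrite -AE (ae_eq_A_const_l w0 w'0 ww') (ae_eq_A_const_r ss').
set E := fock_energy p alpha sigma f in foo.
have EE : fock_energy p alpha sigma' f' = E.
  by rewrite /E (ae_eq_fock_energy_r s0 s'0 ss') (ae_eq_fock_energy_l ff').
have E0 : 0 <= E by exact: fock_energy_ge0.
have Ef : E \is a fin_num by rewrite ge0_fin_numE.
have H (a : R) : (A < a)%R -> weight_ae w (fock_proj_cvg alpha f) /\
    fock_energy p alpha w (fock_proj alpha f) <= (K * a)%:E * E.
  move=> Aa; have a0 : (0 < a)%R by exact: le_lt_trans Aa.
  have Aa' : A_const p r w' sigma' <= a%:E by rewrite AE' lee_fin ltW.
  have foo' : fock_energy p alpha sigma' f' < +oo by rewrite EE.
  have [cv en] := HK sigma' w' a f' hs' hw' dw' a0 Aa' mf' foo'.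
  split.
    apply/(ae_eq_weight_ae w0 w'0 ww').
    by rewrite (ae_eq_fock_proj_cvg ff').
  by rewrite (ae_eq_fock_energy_r w0 w'0 ww') (ae_eq_fock_proj ff') -EE.
have [cv _] := H _ (ltr_pwDr ltr01 (lexx A)); split => //.
have en : fock_energy p alpha w (fock_proj alpha f) <= (K * A)%:E * E.
  rewrite -(fineK Ef); have := fine_ge0 E0; move: H; rewrite -(fineK Ef) /=.
  move: (fine E) => x H x0; apply/lee_addgt0Pr => e e0.
  have Kx : (0 < K * x + 1)%R by rewrite ltr_wpDl// mulr_ge0// ltW.
  have [_ /le_trans] := H (A + e / (K * x + 1))%R (ltr_pwDr (divr_gt0 e0 Kx) (lexx A)).
  apply; rewrite -!EFinM -EFinD lee_fin.
  rewrite mulrDr mulrDl lerD2l -!mulrA mulrCA ler_piMr ?(ltW e0)//.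
  by rewrite mulrCA mulrC ler_pdivrMr// mul1r lerDl.
have := @gt0_ler_poweR R p^-1 _ _ _ _ _ en; rewrite /fock_norm => Hn.
have KA0 : 0 <= (K * A)%:E by rewrite lee_fin mulr_ge0// ltW.
apply: (le_trans (Hn _ _ _)).
- by rewrite invr_ge0 ltW.
- by rewrite in_itv /= leey fock_energy_ge0.
- by rewrite in_itv /= leey mule_ge0.
by rewrite poweRM// poweR_EFin powRM// ltW.
Qed.

(** The energy form requires a positive bound; C = 0 is reached by letting larger
bounds decrease to C. *)
Lemma A_const_root_le_of_bounded alpha r p : (0 < alpha)%R -> (0 < r)%R -> (1 <= p)%R ->
  exists2 K : R, (0 < K)%R & forall sigma w C,
    weight sigma -> weight w -> (0 <= C)%R -> fock_proj_bounded_by p alpha sigma w C ->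
    A_const p r w sigma `^ p^-1 <= (K * C)%:E.
Proof.
move=> al0 r0 p1; have p0 : (0 < p)%R by exact: lt_le_trans p1.
have [K K0 HK] := A_const_le_of_bounded n al0 r0 p1.
exists (K `^ p^-1)%R; first exact: powR_gt0.
move=> sigma w C hs hw C0 HC.
have [s0 _ _] := hs; have [w0 _ _] := hw.
have [sigma' hs' ss'] := weight_borel hs; have [w' hw' ww'] := weight_borel hw.
have [s'0 _ _] := hs'; have [w'0 _ _] := hw'.
have H (c : R) : (C < c)%R -> A_const p r w sigma `^ p^-1 <= (K `^ p^-1 * c)%:E.
  move=> Cc; have c0 : (0 < c)%R by exact: le_lt_trans Cc.
  have en : energy_bounded_by p alpha sigma' w' (c `^ p).
    move=> f mf; rewrite -(ae_eq_fock_energy_r s0 s'0 ss') -(ae_eq_fock_energy_r w0 w'0 ww').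
    apply: energy_bounded_by_of_fock_proj => //; first exact: ltW.
    exact: fock_proj_bounded_by_le (ltW Cc) HC.
  have := HK sigma' w' (c `^ p)%R hs' hw' (powR_gt0 _ c0) en.
  rewrite -(ae_eq_A_const_l w0 w'0 ww') -(ae_eq_A_const_r ss') => AK.
  have := @gt0_ler_poweR R p^-1 _ _ _ _ _ AK => Hn.
  have Kc0 : 0 <= (K * c `^ p)%:E by rewrite lee_fin mulr_ge0 ?powR_ge0// ltW.
  apply: (le_trans (Hn _ _ _)).
  - by rewrite invr_ge0 ltW.
  - by rewrite in_itv /= leey A_const_ge0.
  - by rewrite in_itv /= leey Kc0.
  rewrite poweR_EFin lee_fin powRM ?powR_ge0 ?(ltW K0)//.
  by rewrite -[X in (_ * X <= _)%R]powRrM mulfV ?gt_eqF// powRr1// ltW.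
have Kp0 : (0 < K `^ p^-1)%R by exact: powR_gt0.
apply/lee_addgt0Pr => e e0.
apply: (le_trans (H (C + e / K `^ p^-1)%R _)).
  by rewrite ltrDl divr_gt0.
by rewrite -EFinD lee_fin mulrDr mulrCA mulfV ?gt_eqF// mulr1.
Qed.

End two_bounds.

Theorem theorem1p3 (R : realType) (n : nat) (alpha p r D : R) :
  (0 < n)%N -> 0 < alpha -> 1 <= p -> 0 < r ->
  exists c1 c2 : R, 0 < c1 /\ 0 < c2 /\
    forall sigma w : n.-tuple R[i] -> R,
      weight sigma -> weight w -> doubling r D w ->
      (fock_proj_bounded p alpha sigma w <-> (A_const p r w sigma < +oo)%E) /\
      (fock_proj_norm p alpha sigma w <= c1%:E * A_const p r w sigma `^ p^-1)%E /\
      (A_const p r w sigma `^ p^-1 <= c2%:E * fock_proj_norm p alpha sigma w)%E.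
Proof.
move=> _ al0 p1 r0; have p0 : 0 < p by exact: lt_le_trans p1.
have [D1|D1] := leP 1 D; last first.
  exists 1, 1; do 2!split => //; move=> sigma w _ _ [D1' _].
  by have := lt_le_trans D1 D1'; rewrite ltxx.
have [c1 c10 suff] := fock_proj_bounded_of_A_const n al0 r0 p1 D1.
have [c2 c20 nec] := A_const_root_le_of_bounded n al0 r0 p1.
exists c1, c2; split=> //; split=> // sigma w hs hw dw.
have [s0 _ _] := hs; have [w0 _ _] := hw.
have A0 : (0 <= A_const p r w sigma)%E by exact: A_const_ge0.
have pV0 : p^-1 != 0 by rewrite invr_eq0 gt_eqF.
split; last split.
- split=> [[C HC]|Aoo].
    have HC' : fock_proj_bounded_by p alpha sigma w (Num.max C 0).
      by apply: fock_proj_bounded_by_le HC; rewrite le_max lexx.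
    have C'0 : 0 <= Num.max C 0 by rewrite le_max lexx orbT.
    have := nec sigma w _ hs hw C'0 HC' => /le_lt_trans /(_ (ltry _)).
    exact: lty_poweRy.
  have /fineK AE : A_const p r w sigma \is a fin_num by rewrite ge0_fin_numE.
  by exists (c1 * fine (A_const p r w sigma) `^ p^-1); exact: suff.
- have [->|] := eqVneq (A_const p r w sigma) +oo%E.
    by rewrite poweRyr// gt0_muley ?lte_fin// leey.
  rewrite -ltey -ge0_fin_numE// => /fineK AE.
  apply: ereal_inf_lbound; exists (c1 * fine (A_const p r w sigma) `^ p^-1).
    split; first by rewrite mulr_ge0 ?powR_ge0// ltW.
    exact: suff.
  by rewrite EFinM -poweR_EFin AE.
rewrite -lee_pdivrMl//; apply: le_ereal_inf_tmp => _ [C [C0 HC] <-].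
by rewrite lee_pdivrMl// -EFinM; exact: nec.
Qed.
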